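(* Let $H$ be a finite simple graph that contains a connected induced subgraph $C$ having neither a cut vertex nor an adjacent two-vertex cut. Suppose $H$ has a nonedge $e_0$ such that $H+e_0$ is $C$-free. Then $H$ has a finite deletion host.
   Context: All graphs are simple, undirected and finite. A nonedge is an unordered pair of distinct nonadjacent vertices; $H+e_0$ is $H$ with the edge $e_0$ added. ''$C$-free'' means containing no induced subgraph isomorphic to $C$. A vertex cut of a connected graph is a set of vertices whose removal leaves at least two nonempty components; a cut vertex is a vertex forming a one-element vertex cut; an adjacent two-vertex cut is a vertex cut consisting of the two endpoints of an edge. A finite deletion host for $H$ is a finite graph $G$ such that $E(G)\neq\varnothing$, $G$ is $H$-free (no induced subgraph isomorphic to $H$), and for every $e\in E(G)$ the graph $G-e$ (edge deleted, vertices kept) contains an induced subgraph isomorphic to $H$. *)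

(* Defs.v *)
From mathcomp Require Import all_boot.

Set Implicit Arguments.
Unset Strict Implicit.
Unset Printing Implicit Defensive.

Record sgraph := SGraph {
  vertex :> finType;
  edge : rel vertex;
  edge_sym : symmetric edge;
  edge_irrefl : irreflexive edge
}.

Arguments edge {G} : rename.

Definition nonedge (G : sgraph) (u v : G) : bool := (u != v) && ~~ edge u v.

Section Induced.
Variables (G : sgraph) (S : {set G}).

Definition induced_edge : rel {x : G | x \in S} :=
  fun x y => edge (val x) (val y).

Lemma induced_edge_sym : symmetric induced_edge.
Proof. by move=> x y; rewrite /induced_edge edge_sym. Qed.

Lemma induced_edge_irrefl : irreflexive induced_edge.
Proof. by move=> x; rewrite /induced_edge edge_irrefl. Qed.

Definition induced : sgraph := SGraph induced_edge_sym induced_edge_irrefl.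

End Induced.

Section EdgeModification.
Variables (G : sgraph) (u v : G).

(* The guard [x != y] only matters in the degenerate case [u = v]. *)
Definition add_edge_rel : rel G :=
  fun x y => edge x y || (x != y) && ([set x; y] == [set u; v]).

Lemma add_edge_sym : symmetric add_edge_rel.
Proof. by move=> x y; rewrite /add_edge_rel edge_sym eq_sym setUC. Qed.

Lemma add_edge_irrefl : irreflexive add_edge_rel.
Proof. by move=> x; rewrite /add_edge_rel edge_irrefl eqxx. Qed.

Definition add_edge : sgraph := SGraph add_edge_sym add_edge_irrefl.

Definition del_edge_rel : rel G :=
  fun x y => edge x y && ([set x; y] != [set u; v]).

Lemma del_edge_sym : symmetric del_edge_rel.
Proof. by move=> x y; rewrite /del_edge_rel edge_sym setUC. Qed.

Lemma del_edge_irrefl : irreflexive del_edge_rel.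
Proof. by move=> x; rewrite /del_edge_rel edge_irrefl. Qed.

Definition del_edge : sgraph := SGraph del_edge_sym del_edge_irrefl.

End EdgeModification.

Definition isomorphic (G K : sgraph) : Prop :=
  exists2 f : G -> K, bijective f & forall x y : G, edge (f x) (f y) = edge x y.

Definition contains_induced (G K : sgraph) : Prop :=
  exists S : {set G}, isomorphic (induced S) K.

Definition induced_free (G K : sgraph) : Prop := ~ contains_induced G K.

Definition num_components (G : sgraph) : nat := n_comp (@edge G) predT.

(* The empty graph has no component, hence is not connected. *)
Definition connected (G : sgraph) : bool := num_components G == 1.

(* Intended for connected [G]. *)
Definition vertex_cut (G : sgraph) (X : {set G}) : bool :=
  1 < num_components (induced (~: X)).

Definition has_cut_vertex (G : sgraph) : Prop :=
  exists x : G, vertex_cut [set x].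

Definition has_adjacent_two_vertex_cut (G : sgraph) : Prop :=
  exists x y : G, edge x y /\ vertex_cut [set x; y].

Definition deletion_host (H G : sgraph) : Prop :=
  [/\ exists u v : G, edge u v,
      induced_free G H
    & forall u v : G, edge u v -> contains_induced (del_edge u v) H].

(* Main.v *)
Require Import Defs.
From mathcomp Require Import all_boot all_fingroup cyclic.
From Stdlib Require Import Classical ClassicalEpsilon.

(** Let [A] be [H] with [e0] added. A [C]-free graph with at least one edge, in
    which every edge is the edge [e0] of an induced copy of [A] (a page), is a
    deletion host. Gluing pages along edges in a tree-like way gives an infinite
    such graph: a separating vertex or edge would cut [C], so every copy of [C]
    lies in one page. A finite quotient is obtained from a finite group acting
    on hubs, each hub carrying one page: generators are indexed by the edges of
    an edge-transitive graph containing [A], and the vertices are the orbits of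
    the hubs under the generators at a vertex of that graph. The group is
    chosen so that in a short cycle of such orbits, consecutive ones meeting,
    three consecutive orbits always have a common hub; this is all that the
    separation argument uses about trees. To obtain the group, a violating
    cycle is unrolled into a finite permutation representation, a chain of
    regular orbits glued along cosets, in which the cycle does not close up. *)

Set Implicit Arguments.
Unset Strict Implicit.
Unset Printing Implicit Defensive.

Local Open Scope group_scope.

(** * Finite groups acting on all small permutation representations *)

Section Words.
Variables (T : finType) (gT : finGroupType) (b : T -> gT).

Definition ev (w : seq T) : gT := \prod_(t <- w) b t.

Lemma ev_nil : ev [::] = 1.
Proof. exact: big_nil. Qed.

Lemma ev_cons t w : ev (t :: w) = b t * ev w.
Proof. exact: big_cons. Qed.

Lemma ev_cat w w' : ev (w ++ w') = ev w * ev w'.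
Proof. exact: big_cat. Qed.

Lemma mem_ev (A : pred T) w : all A w -> ev w \in <<[set b t | t in A]>>.
Proof.
elim: w => [|t w IHw] /=; first by rewrite ev_nil group1.
case/andP=> At /IHw wA; rewrite ev_cons groupM // mem_gen //.
exact: imset_f.
Qed.

Lemma gen_ev (A : pred T) g :
  g \in <<[set b t | t in A]>> -> exists2 w, all A w & ev w = g.
Proof.
case/gen_prodgP=> n [c cA ->].
elim: n c cA => [|n IHn] c cA.
  by exists [::]; rewrite // ev_nil big_ord0.
have [w wA Ew] := IHn (fun i => c (lift ord0 i)) (fun i => cA _).
have /imsetP[t At Et] := cA ord0.
by exists (t :: w); rewrite /= ?wA ?andbT // ev_cons big_ord_recl Et Ew.
Qed.

End Words.

Lemma ev_perm_cons (T I : finType) (a : T -> {perm I}) t w i :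
  ev a (t :: w) i = ev a w (a t i).
Proof. by rewrite ev_cons permM. Qed.

Lemma ev_perm_cat (T I : finType) (a : T -> {perm I}) w w' i :
  ev a (w ++ w') i = ev a w' (ev a w i).
Proof. by rewrite ev_cat permM. Qed.

Lemma ev_perm_nil (T I : finType) (a : T -> {perm I}) i : ev a [::] i = i.
Proof. by rewrite ev_nil perm1. Qed.

Section Universal.
Variables (T : finType) (n : nat) (V : pred {ffun T -> {perm 'I_n}}).

Let M := ({ffun T -> {perm 'I_n}} * 'I_n)%type.

(** A disjoint union of copies of ['I_n], one per tuple [c]; the copies failing [V] are fixed, so a
    relation holds here exactly when it holds in every tuple satisfying [V]. *)
Definition universal_fun t (m : M) : M :=
  (m.1, if V m.1 then m.1 t m.2 else m.2).

Lemma universal_inj t : injective (universal_fun t).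
Proof.
move=> [c i] [d j] [/= <-]; case: (V c) => [/perm_inj->|->] //.
Qed.

Definition universal t : {perm M} := perm (@universal_inj t).

Lemma ev_universal w m :
  ev universal w m = (m.1, if V m.1 then ev m.1 w m.2 else m.2).
Proof.
elim: w m => [|t w IHw] [c i] /=; first by rewrite !ev_perm_nil if_same.
rewrite ev_perm_cons permE IHw /universal_fun /=.
by case: (V c); rewrite ?ev_perm_cons.
Qed.

Lemma ev_universalP w w' :
  ev universal w = ev universal w' <-> forall c, V c -> ev c w = ev c w'.
Proof.
split=> [E c Vc | E].
  apply/permP=> i; move/permP/(_ (c, i)): E.
  by rewrite !ev_universal /= Vc => -[].
by apply/permP=> -[c i]; rewrite !ev_universal /=; case: ifP => // /E->.
Qed.

End Universal.

(** Realises a small closed set inside a tuple acting on ['I_n.+1], where the relations of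
    [universal] can be tested. *)
Lemma transport (T I : finType) (a : T -> {perm I}) (A : pred T) (P : {set I}) n :
    (forall t i, A t -> i \in P -> a t i \in P) -> #|P| <= n.+1 ->
  exists (phi : I -> 'I_n.+1) (c : {ffun T -> {perm 'I_n.+1}}),
    [/\ {in P &, injective phi},
        forall t i, A t -> i \in P -> c t (phi i) = phi (a t i),
        forall t j, ~~ A t -> c t j = j
      & forall t j, (forall i, i \in P -> phi i != j) -> c t j = j].
Proof.
move=> Pcl Pn; pose phi i : 'I_n.+1 := inord (index i (enum P)).
have phiI : {in P &, injective phi}.
  move=> i j iP jP /(congr1 val).
  have lt k : k \in P -> index k (enum P) < n.+1.
    by move=> kP; apply: leq_trans Pn; rewrite cardE index_mem mem_enum.
  rewrite /= !inordK ?lt // => /(congr1 (nth i (enum P))).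
  by rewrite !nth_index ?mem_enum.
pose F t j := if A t then
  (if [pick i in P | phi i == j] is Some i then phi (a t i) else j) else j.
have F1 t i : A t -> i \in P -> F t (phi i) = phi (a t i).
  move=> At iP; rewrite /F At; case: pickP => [k /andP[kP /eqP]|/(_ i)].
    by move/(phiI _ _ kP iP)->.
  by rewrite iP eqxx.
have F2 t j : (forall i, i \in P -> phi i != j) -> F t j = j.
  move=> nj; rewrite /F; case: (A t) => //; case: pickP => // i /andP[iP].
  by rewrite (negPf (nj i iP)).
have Fdec j : (exists2 i, i \in P & phi i = j) \/ (forall i, i \in P -> phi i != j).
  case: (pickP (fun i => (i \in P) && (phi i == j))) => [i /andP[iP /eqP]|N].
    by left; exists i.
  by right=> i iP; have := N i; rewrite iP /= => ->.
have Finj t : injective (F t).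
  have [At|nAt] := boolP (A t); last by rewrite /F (negPf nAt).
  move=> j1 j2; case: (Fdec j1) => [[i1 P1 <-]|N1]; case: (Fdec j2) => [[i2 P2 <-]|N2].
  - by rewrite !F1 // => /(phiI _ _ (Pcl _ _ At P1) (Pcl _ _ At P2)) /perm_inj->.
  - rewrite F1 // (F2 _ _ N2) => E.
    by have := N2 _ (Pcl _ _ At P1); rewrite E eqxx.
  - rewrite F1 // (F2 _ _ N1) => E.
    by have := N1 _ (Pcl _ _ At P2); rewrite E eqxx.
  - by rewrite !F2.
exists phi, [ffun t => perm (@Finj t)]; split=> //.
- by move=> t i At iP; rewrite ffunE permE F1.
- by move=> t j nAt; rewrite ffunE permE /F (negPf nAt).
- by move=> t j nj; rewrite ffunE permE F2.
Qed.

(** * Connectedness and vertex cuts *)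

Lemma edge_connect_sym (G : sgraph) : connect_sym (@edge G).
Proof. exact/sym_connect_sym/edge_sym. Qed.

Lemma connected_connect (G : sgraph) (x y : G) : connected G -> connect edge x y.
Proof.
rewrite /connected /num_components => /eqP/eqP; rewrite eq_sym => /eqP G1.
have sym := @edge_connect_sym G; apply/(rootP sym).
have in_roots z : root edge z \in predI (roots (@edge G)) predT.
  by rewrite inE roots_root.
have /card_le1_eqP : #|predI (roots (@edge G)) predT| <= 1 by rewrite [#|_|](esym G1).
by apply.
Qed.

Lemma closed_connected (G : sgraph) (R : {set G}) (x y : G) :
    connected G -> (forall a b, a \in R -> edge a b -> b \in R) ->
  x \in R -> y \in R.
Proof.
move=> Gc Rcl xR; have /connectP[p xp ->] := connected_connect x y Gc.
elim: p x xR xp => //= z p IHp x xR /andP[xz zp].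
by apply: IHp zp; apply: Rcl xz.
Qed.

Lemma closed_vertex_cut (G : sgraph) (Z R : {set G}) x y :
    (forall a b, a \in R -> edge a b -> b \notin Z -> b \in R) ->
    x \in R -> x \notin Z -> y \notin R -> y \notin Z ->
  vertex_cut Z.
Proof.
move=> Rcl xR xZ yR yZ; rewrite /vertex_cut /num_components.
have xZ' : x \in ~: Z by rewrite inE.
have yZ' : y \in ~: Z by rewrite inE.
pose x' : induced (~: Z) := Sub x xZ'; pose y' : induced (~: Z) := Sub y yZ'.
have sym := @edge_connect_sym (induced (~: Z)).
apply/card_gt1P; exists (root edge x'), (root edge y').
rewrite !inE !roots_root //; split=> //.
apply: contraNneq yR => /(rootP sym) /connectP[p x'p Ey].
rewrite -[y]/(val y') Ey; have : val x' \in R by [].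
elim: p x' {Ey} x'p => //= z p IHp a /andP[az zp] aR; apply: IHp zp _.
by apply: Rcl az _ => //; have := valP z; rewrite inE.
Qed.

Lemma ev_restrict (T : finType) (gT : finGroupType) (b : T -> gT) (be : pred T) w :
  ev (fun t => if be t then b t else 1) w = ev b (filter be w).
Proof. by rewrite /ev big_filter [RHS]big_mkcond. Qed.

Lemma eq_ev (T : finType) (gT : finGroupType) (b b' : T -> gT) w :
  b =1 b' -> ev b w = ev b' w.
Proof. by move=> E; apply: eq_bigr. Qed.

Lemma ev_nseq (T : finType) (gT : finGroupType) (b : T -> gT) t k :
  ev b (nseq k t) = b t ^+ k.
Proof. by elim: k => [|k IHk]; rewrite ?ev_nil // ev_cons IHk expgS. Qed.

(** * Acyclic finite groups *)

Section Acyclic.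
Variables (X T : finType) (letters : X -> pred T) (k n : nat).
(** The model: [X] is the vertex set of a graph, [T] its edge set, and [letters x] the edges at
    [x]. *)
Hypothesis letters_pair : forall x y t t', x != y ->
  letters x t -> letters y t -> letters x t' -> letters y t' -> t = t'.
Hypothesis letters_triple : forall x y z t, x != y ->
  letters x t -> letters y t -> letters z t -> z = x \/ z = y.
Hypothesis k_gt0 : 0 < k.

(** The exponent [k] bounds the overlaps of pieces ([card_shared]) independently of [n], which is
    chosen after [k]. *)
Definition torsion (c : {ffun T -> {perm 'I_n.+1}}) := [forall t, c t ^+ k == 1].
Local Notation G1 := {perm ({ffun T -> {perm 'I_n.+1}} * 'I_n.+1)}.
Definition gen1 : T -> G1 := universal torsion.

Lemma gen1_order t : gen1 t ^+ k = 1.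
Proof.
rewrite -ev_nseq -(ev_nil gen1); apply/ev_universalP=> c /forallP/(_ t)/eqP.
by rewrite ev_nseq ev_nil.
Qed.

(* Killing the letters outside [be] preserves [torsion], hence is a retraction. *)
Lemma gen1_filter (be : pred T) w w' :
  ev gen1 w = ev gen1 w' -> ev gen1 (filter be w) = ev gen1 (filter be w').
Proof.
move=> /ev_universalP E; apply/ev_universalP=> c /forallP Vc.
pose c' := [ffun t => if be t then c t else 1].
have Ec u : ev c' u = ev c (filter be u).
  by rewrite -ev_restrict; apply: eq_ev => t; rewrite ffunE.
rewrite -!Ec; apply: E; apply/forallP=> t; rewrite ffunE.
by case: ifP => _; rewrite ?expg1n.
Qed.

Definition both x y : pred T := [pred t | letters x t && letters y t].
Definition shared x y : {group G1} := <<[set gen1 t | t in both x y]>>.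

Lemma shared_word x y g : g \in shared x y -> exists2 w, all (both x y) w & ev gen1 w = g.
Proof. exact: gen_ev. Qed.

Lemma word_shared x y w : all (both x y) w -> ev gen1 w \in shared x y.
Proof. exact: mem_ev. Qed.

Lemma gen1_shared x y t : letters x t -> letters y t -> gen1 t \in shared x y.
Proof. by move=> xt yt; rewrite mem_gen // imset_f // inE xt yt. Qed.

Lemma all_bothl x y w : all (both x y) w -> all (letters x) w.
Proof. by apply: sub_all => t /andP[]. Qed.

Lemma all_bothr x y w : all (both x y) w -> all (letters y) w.
Proof. by apply: sub_all => t /andP[]. Qed.

Lemma all_both x y w : all (letters x) w -> all (both x y) (filter (letters y) w).
Proof.
move=> xw; apply/allP=> t; rewrite mem_filter => /andP[yt tw].
by apply/andP; split; last exact: yt; apply: (allP xw).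
Qed.

Lemma card_shared x y : x != y -> #|shared x y| <= k.
Proof.
move=> xy; case: (pickP (both x y)) => [t /andP[xt yt]|N].
  suff -> : shared x y = <[gen1 t]> :> {set _}.
    by rewrite -orderE dvdn_leq // cyclic.order_dvdn gen1_order.
  congr <<_>>; apply/setP=> g; rewrite inE; apply/imsetP/eqP.
    by case=> t' /andP[xt' yt'] ->; rewrite (letters_pair xy xt' yt' xt yt).
  by move=> ->; exists t; rewrite // inE xt.
rewrite (_ : shared x y = 1%g :> {set _}) ?cards1 //.
rewrite /shared /= (_ : imset _ _ = set0) ?gen0 //.
apply/setP=> g; rewrite inE; apply/negP=> /imsetP[t tb _].
by have := N t; rewrite (tb : both x y t).
Qed.

Lemma filter_triple x y z w : x != y -> z != x -> z != y ->
  all (both x y) w -> filter (letters z) w = [::].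
Proof.
move=> xy zx zy xyw; apply/eqP; rewrite -[_ == _]negbK -has_filter.
apply/hasPn=> t /(allP xyw) /andP[xt yt]; apply/negP=> zt.
by case: (letters_triple xy xt yt zt) => E; rewrite E eqxx in zx zy.
Qed.

(** Killing the letters outside [z] keeps a word over [both y z] but erases a word over [both x y],
    since no letter belongs to three points. *)
Lemma shared_inter x y z g : x != y -> z != x -> z != y ->
  g \in shared x y -> g \in shared y z -> g = 1.
Proof.
move=> xy zx zy /shared_word[w xyw Ew] /shared_word[w' yzw' Ew'].
have := @gen1_filter (letters z) w w'; rewrite Ew Ew' (filter_triple xy zx zy xyw).
by rewrite (all_filterP (all_bothr yzw')) Ew' ev_nil => <-.
Qed.

(* Only the relations of [gen1] among the letters of one point of [X] are kept:
   the group [gen2] below acts on all valid sets, so its subgroups generated by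
   the letters of one point are still those of [gen1]. *)
Definition valid (I : finType) (a : T -> {perm I}) :=
  forall z w w', all (letters z) w -> all (letters z) w' ->
  ev gen1 w = ev gen1 w' -> ev a w = ev a w'.

Definition small (I : finType) (a : T -> {perm I}) z i m :=
  exists P : {set I},
    [/\ i \in P, forall t j, letters z t -> j \in P -> a t j \in P & #|P| <= m].

Lemma small_le (I : finType) (a : T -> {perm I}) z i m m' :
  m <= m' -> small a z i m -> small a z i m'.
Proof. by move=> le [P [iP Pcl /leq_trans Pm]]; exists P; split; rewrite ?Pm. Qed.

Lemma valid_order (I : finType) (a : T -> {perm I}) z t :
  valid a -> letters z t -> a t ^+ k = 1.
Proof.
move=> Va zt; rewrite -ev_nseq -(ev_nil a); apply: (Va z) => //.
  by rewrite all_nseq zt orbT.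
by rewrite ev_nseq ev_nil gen1_order.
Qed.

(* [gen1] already acts on every set of at most [n.+1] points, so closed sets of
   that size satisfy its relations for free. *)
Lemma small_valid (I : finType) (a : T -> {perm I}) z i w w' :
    (forall t, letters z t -> a t ^+ k = 1) -> small a z i n.+1 ->
    all (letters z) w -> all (letters z) w' -> ev gen1 w = ev gen1 w' ->
  ev a w i = ev a w' i.
Proof.
move=> ak [P [iP Pcl Pn]] zw zw' /ev_universalP E.
have [phi [c [phiI c1 c2 c3]]] := transport Pcl Pn.
have evc u j : all (letters z) u -> j \in P ->
    ev c u (phi j) = phi (ev a u j) /\ ev a u j \in P.
  elim: u j => [|t u IHu] j /=; first by rewrite !ev_perm_nil.
  case/andP=> zt zu jP; rewrite !ev_perm_cons c1 //.
  by apply: IHu => //; apply: Pcl.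
have [E1 P1] := evc w i zw iP; have [E2 P2] := evc w' i zw' iP.
apply: phiI => //; rewrite -E1 -E2 (E c) //; apply/forallP=> t.
apply/eqP/permP=> j; rewrite perm1.
have [zt|nzt] := boolP (letters z t); last first.
  by rewrite permX iter_fix // c2.
have [/imsetP[i' i'P ->]|nj] := boolP (j \in [set phi i' | i' in P]).
  rewrite -ev_nseq (evc _ _ _ i'P).1 ?all_nseq ?zt ?orbT //.
  by rewrite ev_nseq ak ?perm1.
rewrite permX iter_fix // c3 // => i' i'P; apply: contraNneq nj => <-.
exact: imset_f.
Qed.

(** A place for attaching a new piece: no letter outside [x] moves the point yet, and the letters of
    any other point of [X] keep it in a set of bounded size. *)
Definition fresh (I : finType) (a : T -> {perm I}) x i m :=
  (forall t, ~~ letters x t -> a t i = i) /\ (forall z, z != x -> small a z i m).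

Fixpoint walk (I : finType) (a : T -> {perm I}) (Y : {set I}) (p : I) U e :=
  if U is t :: U' then p \in Y /\ walk a Y (a t p) U' e else p = e.

Lemma walk_ev (I : finType) (a : T -> {perm I}) (Y : {set I}) p U e :
  walk a Y p U e -> ev a U p = e.
Proof.
elim: U p => [|t U IHU] p /=; first by rewrite ev_perm_nil.
by case=> _ /IHU; rewrite ev_perm_cons.
Qed.

(* [e] is the base point of the last piece, a regular orbit of the generators at
   [x]; the piece is attached to the earlier ones along the coset [K], [p] is the
   start of the path [U] that leads to [e], and [Y] contains the points which that
   path has already left. *)
Record chain_end (I : finType) (a : T -> {perm I}) (x : X) (K : {set G1})
    (e p : I) (U : seq T) (Y : {set I}) (m : nat) : Prop := ChainEnd {
  ce_valid : valid a;
  ce_regular : forall w w', all (letters x) w -> all (letters x) w' ->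
    ev a w e = ev a w' e -> ev gen1 w = ev gen1 w';
  ce_fresh : forall w, all (letters x) w -> ev gen1 w \notin K ->
    fresh a x (ev a w e) m /\ ev a w e \notin Y;
  ce_walk : walk a Y p U e }.

Definition regular x t : G1 -> G1 := fun g => if letters x t then g * gen1 t else g.

Lemma regular_inj x t : injective (regular x t).
Proof. by rewrite /regular => g h; case: ifP => // _ /mulIg. Qed.

Definition regular_perm x t : {perm G1} := perm (@regular_inj x t).

Lemma regular_permE x t g : regular_perm x t g = if letters x t then g * gen1 t else g.
Proof. by rewrite permE. Qed.

Lemma ev_regular x w g : ev (regular_perm x) w g = g * ev gen1 (filter (letters x) w).
Proof.
elim: w g => [|t w IHw] g /=; first by rewrite ev_perm_nil ev_nil mulg1.
by rewrite ev_perm_cons IHw regular_permE; case: ifP => _; rewrite // ev_cons mulgA.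
Qed.

Lemma small_regular x z g : z != x -> small (regular_perm x) z g k.
Proof.
move=> zx; exists (g *: shared x z); split; first exact: lcoset_refl.
  move=> t h zt /lcosetP[c cK ->]; rewrite regular_permE; case: ifP => [xt|_].
    by rewrite -mulgA mem_lcoset mulKg groupM // gen1_shared.
  by rewrite mem_lcoset mulKg.
by rewrite card_lcoset card_shared // eq_sym.
Qed.

(** Right multiplication by the letters at [x] satisfies the relations of [gen1], because killing
    the other letters is a retraction. *)
Lemma chain_start x : chain_end (regular_perm x) x set0 1 1 [::] set0 k.
Proof.
split=> //.
- move=> z w w' _ _ E; apply/permP=> g; rewrite !ev_regular.
  by congr (_ * _); apply: gen1_filter.
- by move=> w w' xw xw'; rewrite !ev_regular !mul1g !(all_filterP _).
- move=> w xw _; split; last by rewrite inE.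
  split; last by move=> z zx; apply: small_regular.
  by move=> t /negPf nxt; rewrite regular_permE nxt.
Qed.

(* A new regular piece for [y] is attached at [q]: the point [inr h] of the new
   piece is identified with [inl (qa h)] for [h] in [shared x y]. Instead of forming a
   quotient, [swap] exchanges the two, and the unused copies remain as junk. *)
Section Glue.
Variables (I : finType) (a : T -> {perm I}) (x y : X) (K : {set G1}).
Variables (e p : I) (U W : seq T) (Y : {set I}) (m : nat).
Hypothesis ceI : chain_end a x K e p U Y m.
Hypothesis xy : x != y.
Hypothesis xW : all (letters x) W.
Hypothesis WK : forall h, h \in shared x y -> ev gen1 W * h \notin K.
Hypothesis km : k <= m.
(** A gluing multiplies the orbit bound by at most [k.+1] ([card_thick]); up to [n.+1] points,
    [small_valid] yields the relations of [gen1]. *)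
Hypothesis mn : m * k.+1 <= n.+1.

Let q := ev a W e.
Let wd h := epsilon (inhabits [::]) (fun w => all (both x y) w /\ ev gen1 w = h).
Let qa h := ev a (wd h) q.

Lemma wdP h : h \in shared x y -> all (both x y) (wd h) /\ ev gen1 (wd h) = h.
Proof.
case/shared_word=> w xyw Ew; rewrite /wd.
set P := fun w => _; apply: (epsilon_spec (inhabits [::]) P).
by exists w.
Qed.

(** [wd] is an arbitrary choice of word; validity of [a] makes [qa] independent of it. *)
Lemma qa_word w : all (both x y) w -> qa (ev gen1 w) = ev a w q.
Proof.
move=> xyw; have [xyv Ev] := wdP (word_shared xyw).
by rewrite /qa (ce_valid ceI (all_bothl xyv) (all_bothl xyw)).
Qed.

Lemma qa1 : qa 1 = q.
Proof. by rewrite -(ev_nil gen1) qa_word // ev_perm_nil. Qed.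

Lemma qaM h t : h \in shared x y -> letters x t -> letters y t -> qa (h * gen1 t) = a t (qa h).
Proof.
case/wdP=> xyv {1}<- xt yt.
rewrite -[gen1 t]mulg1 -(ev_nil gen1) -ev_cons -ev_cat qa_word.
  by rewrite ev_perm_cat ev_perm_cons ev_perm_nil.
by rewrite all_cat xyv /= /both /= xt yt.
Qed.

Lemma qa_inj : {in shared x y &, injective qa}.
Proof.
move=> h h' /wdP[xyv Ev] /wdP[xyv' Ev']; rewrite /qa /q -!ev_perm_cat => E.
have := ce_regular ceI _ _ E.
rewrite !all_cat xW (all_bothl xyv) (all_bothl xyv') => /(_ isT isT).
by rewrite !ev_cat Ev Ev' => /mulgI.
Qed.

Lemma qa_fresh h : h \in shared x y -> fresh a x (qa h) m /\ qa h \notin Y.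
Proof.
move=> hK; have [xyv Ev] := wdP hK.
rewrite /qa /q -ev_perm_cat; apply: (ce_fresh ceI).
  by rewrite all_cat xW (all_bothl xyv).
by rewrite ev_cat Ev WK.
Qed.

Let swap (s : I + G1) : I + G1 :=
  match s with
  | inl i => if [pick h in shared x y | qa h == i] is Some h then inr h else inl i
  | inr g => if g \in shared x y then inl (qa g) else inr g
  end.

Lemma swap_inr h : h \in shared x y -> swap (inr h) = inl (qa h).
Proof. by rewrite /= => ->. Qed.

Lemma swap_out g : g \notin shared x y -> swap (inr g) = inr g.
Proof. by rewrite /= => /negPf->. Qed.

Lemma swap_qa h : h \in shared x y -> swap (inl (qa h)) = inr h.
Proof.
move=> hK /=; case: pickP => [h' /andP[h'K /eqP E]|/(_ h)]; last by rewrite hK eqxx.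
by rewrite (qa_inj h'K hK E).
Qed.

Lemma swap_inl i : (exists2 h, h \in shared x y & i = qa h) \/
  (forall h, h \in shared x y -> i <> qa h) /\ swap (inl i) = inl i.
Proof.
rewrite /=; case: pickP => [h /andP[hK /eqP E]|N]; first by left; exists h.
right; split=> // h hK E; have := N h; by rewrite hK -E eqxx.
Qed.

Lemma swapK : involutive swap.
Proof.
case=> [i|g].
  by case: (swap_inl i) => [[h hK ->]|[_ E]]; rewrite ?swap_qa ?swap_inr ?E.
have [gK|gnK] := boolP (g \in shared x y); first by rewrite swap_inr ?swap_qa.
by rewrite !swap_out.
Qed.

Let side t (s : I + G1) : I + G1 :=
  match s with inl i => inl (a t i) | inr g => inr (regular_perm y t g) end.

(** A letter at [y] must see the identified points as part of the new piece, which conjugation by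
    [swap] achieves; every other letter acts on the two sides separately. *)
Let glue_fun t s := if letters y t then swap (side t (swap s)) else side t s.

Lemma glue_inj t : injective (glue_fun t).
Proof.
have side_inj : injective (side t).
  by case=> [i|g] [j|h] //= [/perm_inj->].
move=> s s'; rewrite /glue_fun; case: ifP => _; last exact: side_inj.
by move=> /(can_inj swapK) /side_inj /(can_inj swapK).
Qed.

Definition glue t : {perm (I + G1)%type} := perm (@glue_inj t).

Lemma glue_inrN t g : letters y t -> glue t (swap (inr g)) = swap (inr (g * gen1 t)).
Proof. by move=> yt; rewrite permE /glue_fun yt swapK [side _ _]/= regular_permE yt. Qed.

Lemma glue_inlN t i : letters y t -> glue t (swap (inl i)) = swap (inl (a t i)).
Proof. by move=> yt; rewrite permE /glue_fun yt swapK. Qed.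

Lemma glue_out_inl t i : ~~ letters y t -> glue t (inl i) = inl (a t i).
Proof. by move/negPf=> yt; rewrite permE /glue_fun yt. Qed.

Lemma glue_out_inr t g : ~~ letters y t -> glue t (inr g) = inr g.
Proof. by move/negPf=> yt; rewrite permE /glue_fun yt [side _ _]/= regular_permE yt. Qed.

(** By [qaM], a letter at both [x] and [y] acts on the overlap in the same way from either side, so
    the swap does not show. *)
Lemma glue_x_inl t i : letters x t -> glue t (inl i) = inl (a t i).
Proof.
move=> xt; have [yt|] := boolP (letters y t); last exact: glue_out_inl.
case: (swap_inl i) => [[h hK ->]|[N E]].
  rewrite -(swap_inr hK) glue_inrN // -qaM // swap_inr //.
  by rewrite groupM ?gen1_shared.
rewrite -{1}E glue_inlN //; case: (swap_inl (a t i)) => [[h hK Eh]|[_ ->]] //.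
case: (N (h * (gen1 t)^-1)); first by rewrite groupM ?groupV ?gen1_shared.
apply: (@perm_inj _ (a t)); rewrite Eh -qaM ?mulgKV //.
by rewrite groupM ?groupV ?gen1_shared.
Qed.

Lemma glue_x_inr t g : letters x t -> glue t (inr g) = inr (regular_perm y t g).
Proof.
move=> xt; have [yt|yt] := boolP (letters y t); last first.
  by rewrite glue_out_inr // regular_permE (negPf yt).
have bK := gen1_shared xt yt; rewrite regular_permE yt.
have [gK|gK] := boolP (g \in shared x y).
  rewrite -{1}(swap_qa gK) glue_inlN // -qaM // swap_qa //.
  by rewrite groupM.
by rewrite -{1}(swap_out gK) glue_inrN // swap_out // groupMr.
Qed.

(** A letter at [y] but not at [x] fixes the overlap in the old action, by freshness, hence cannot
    carry an outside point into it. *)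
Lemma glue_off t i : (forall h, h \in shared x y -> i <> qa h) ->
  glue t (inl i) = inl (a t i).
Proof.
move=> N; have [xt|xt] := boolP (letters x t); first exact: glue_x_inl.
have [yt|] := boolP (letters y t); last exact: glue_out_inl.
case: (swap_inl i) => [[h hK /(N h hK)]|[_ E]] //.
rewrite -{1}E glue_inlN //; case: (swap_inl (a t i)) => [[h hK Eh]|[_ ->]] //.
case: (N h hK); apply: (@perm_inj _ (a t)); rewrite Eh.
by rewrite (qa_fresh hK).1.1.
Qed.

Lemma glue_junk t h : h \in shared x y -> ~~ letters x t -> glue t (inr h) = inr h.
Proof.
move=> hK xt; have [yt|] := boolP (letters y t); last exact: glue_out_inr.
by rewrite -{1}(swap_qa hK) glue_inlN // (qa_fresh hK).1.1 // swap_qa.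
Qed.

Lemma ev_glue_y w s : all (letters y) w ->
  ev glue w (swap s) =
  swap match s with inl i => inl (ev a w i) | inr g => inr (g * ev gen1 w) end.
Proof.
elim: w s => [|t w IHw] s /=.
  by rewrite ev_perm_nil; case: s => s; rewrite ?ev_perm_nil // ev_nil mulg1.
case/andP=> yt yw; rewrite ev_perm_cons; case: s => s.
  by rewrite glue_inlN // IHw // ev_perm_cons.
by rewrite glue_inrN // IHw // ev_cons mulgA.
Qed.

Lemma ev_glue_x w s : all (letters x) w ->
  ev glue w s =
  match s with inl i => inl (ev a w i) | inr g => inr (ev (regular_perm y) w g) end.
Proof.
elim: w s => [|t w IHw] s /=.
  by rewrite ev_perm_nil; case: s => s; rewrite ?ev_perm_nil.
case/andP=> xt xw; rewrite !ev_perm_cons; case: s => s.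
  by rewrite glue_x_inl // IHw // ev_perm_cons.
by rewrite glue_x_inr // IHw // ev_perm_cons.
Qed.

(* [P] enlarged by the blocks of the new piece that are attached to it. *)
Let thick z (P : {set I}) : {set I + G1} :=
  [set inl i | i in P] :|:
  [set inr (hc.1 * hc.2) |
     hc in setX [set h in shared x y | qa h \in P] (shared y z)].

Lemma mem_thick_inl z (P : {set I}) i : (inl i \in thick z P) = (i \in P).
Proof.
rewrite !inE mem_imset; last by move=> ? ? [].
by rewrite orbC; case: imsetP => // -[].
Qed.

Lemma mem_thick_inr z (P : {set I}) h c :
  h \in shared x y -> qa h \in P -> c \in shared y z -> inr (h * c) \in thick z P.
Proof.
move=> hK hP cK; rewrite inE; apply/orP; right.
by apply/imsetP; exists (h, c); rewrite // !inE hK hP cK.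
Qed.

Lemma card_thick z (P : {set I}) : y != z -> #|thick z P| <= #|P| * k.+1.
Proof.
move=> yz; apply: leq_trans (leq_card_setU _ _) _.
rewrite mulnS leq_add ?leq_imset_card //.
apply: leq_trans (leq_imset_card _ _) _; rewrite cardsX leq_mul ?card_shared //.
rewrite -(card_in_imset (f := qa)).
  by apply/subset_leq_card/subsetP=> _ /imsetP[h /setIdP[_ hP] ->].
by move=> h h' /setIdP[hK _] /setIdP[h'K _]; apply: qa_inj.
Qed.

(** A letter at both [y] and [z] moves [inr (h * c)] inside its block [h *: shared y z]. By
    [shared_inter] the block meets the overlap only at [h], whose role is played by [inl (qa h)]. *)
Lemma thick_closed z (P : {set I}) t s : z != x -> z != y ->
    (forall t j, letters z t -> j \in P -> a t j \in P) ->
  letters z t -> s \in thick z P -> glue t s \in thick z P.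
Proof.
move=> zx zy Pcl zt.
have xt : letters y t -> letters x t = false.
  move=> yt; apply/negP=> xt; have := letters_triple xy xt yt zt.
  by case=> E; rewrite E eqxx in zx zy.
have onK h c : h \in shared x y -> qa h \in P -> c \in shared y z ->
    swap (inr (h * c)) \in thick z P.
  move=> hK hP cK; have [hcK|hcK] := boolP (h * c \in shared x y).
    have cxy : c \in shared x y by rewrite -(mulKg h c) groupM ?groupV.
    by rewrite (shared_inter xy zx zy cxy cK) mulg1 swap_inr // mem_thick_inl.
  by rewrite swap_out // mem_thick_inr.
case: s => [i|g].
  rewrite mem_thick_inl => iP; case: (swap_inl i) => [[h hK E]|[N _]].
    have [yt|yt] := boolP (letters y t); last by rewrite glue_out_inl // mem_thick_inl Pcl.
    rewrite E -(swap_inr hK) glue_inrN //; apply: onK; rewrite -?E //.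
    exact: gen1_shared.
  by rewrite glue_off // mem_thick_inl Pcl.
case/setUP=> /imsetP[] // [h c] /setXP[/setIdP[hK hP] /= cK] [->].
have [yt|yt] := boolP (letters y t); last by rewrite glue_out_inr // mem_thick_inr.
have [hcK|hcK] := boolP (h * c \in shared x y).
  by rewrite glue_junk ?xt // mem_thick_inr.
rewrite -(swap_out hcK) glue_inrN // -mulgA; apply: onK => //.
by rewrite groupM // gen1_shared.
Qed.

(** For [z != x], the coset [g *: shared y z] either meets the overlap, at a point whose small old
    orbit is thickened, or is closed by itself. *)
Lemma small_inr z g : z != y -> small glue z (inr g) (m * k.+1).
Proof.
move=> zy; have kmk : k <= m * k.+1.
  by apply: leq_trans km _; rewrite leq_pmulr.
have m0 : 0 < m * k.+1 by apply: leq_trans kmk.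
have [-> {zy}|zx] := eqVneq z x.
  exists [set inr h | h in g *: shared y x]; split.
  - by apply: imset_f; apply: lcoset_refl.
  - move=> t s xt /imsetP[h hg ->]; rewrite glue_x_inr //; apply: imset_f.
    rewrite regular_permE; case: ifP => // yt; case/lcosetP: hg => c cK ->.
    by rewrite -mulgA mem_lcoset mulKg groupM // gen1_shared.
  - apply: leq_trans (leq_imset_card _ _) _; rewrite card_lcoset.
    by apply: leq_trans kmk; apply: card_shared; rewrite eq_sym.
have [gK|gK] := boolP (g \in shared x y).
  have [P [hP Pcl Pm]] := (qa_fresh gK).1.2 z zx.
  exists (thick z P); split; last first.
  - apply: leq_trans (card_thick _ _) _; first by rewrite eq_sym.
    by rewrite leq_mul2r Pm orbT.
  - by move=> t s; apply: thick_closed.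
  - by rewrite -[g]mulg1 mem_thick_inr.
have [/exists_inP[c cK gcK]|N] := boolP [exists c in shared y z, g * c \in shared x y].
  have [P [hP Pcl Pm]] := (qa_fresh gcK).1.2 z zx.
  exists (thick z P); split; last first.
  - apply: leq_trans (card_thick _ _) _; first by rewrite eq_sym.
    by rewrite leq_mul2r Pm orbT.
  - by move=> t s; apply: thick_closed.
  - by rewrite -(mulgK c g) mem_thick_inr ?groupV.
exists [set inr h | h in g *: shared y z]; split.
- by apply: imset_f; apply: lcoset_refl.
- move=> t s zt /imsetP[h /lcosetP[c cK ->] ->].
  have [yt|yt] := boolP (letters y t); last first.
    by rewrite glue_out_inr // imset_f // mem_lcoset mulKg.
  have out d : d \in shared y z -> g * d \notin shared x y.
    by move=> dK; apply: contra N => gdK; apply/exists_inP; exists d.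
  rewrite -(swap_out (out c cK)) glue_inrN // -mulgA.
  have dK : c * gen1 t \in shared y z by rewrite groupM // gen1_shared.
  by rewrite swap_out ?out // imset_f // mem_lcoset mulKg.
- apply: leq_trans (leq_imset_card _ _) _; rewrite card_lcoset.
  by apply: leq_trans kmk; apply: card_shared; rewrite eq_sym.
Qed.

Lemma closed_ev z (P : {set I}) w i :
    (forall t j, letters z t -> j \in P -> a t j \in P) ->
  all (letters z) w -> ev a w i \in P -> i \in P.
Proof.
move=> Pcl; elim: w i => [|t w IHw] i /=; first by rewrite ev_perm_nil.
case/andP=> zt zw; rewrite ev_perm_cons => /(IHw _ zw) atP.
have aP : a t @: P = P.
  apply/eqP; rewrite eqEcard card_imset ?leqnn ?andbT; last exact: perm_inj.
  by apply/subsetP=> _ /imsetP[j jP ->]; apply: Pcl.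
by rewrite -aP mem_imset // in atP; apply: perm_inj.
Qed.

(** At [y] the action is conjugate to the old one beside a regular one; at [x] it is the old one
    beside a retraction of a regular one. At any other [z] the new points have small orbits, and an
    old orbit either reaches the overlap, and is then small, or stays in the old action. *)
Lemma glue_valid : valid glue.
Proof.
have Va := ce_valid ceI.
have gk z t : letters z t -> glue t ^+ k = 1.
  move=> zt; rewrite -ev_nseq; apply/permP=> s; rewrite perm1.
  have [yt|yt] := boolP (letters y t).
    rewrite -{1}(swapK s) ev_glue_y ?all_nseq ?yt ?orbT //.
    rewrite -[RHS]swapK !ev_nseq gen1_order (valid_order Va zt).
    by case: (swap s) => s'; rewrite ?perm1 ?mulg1.
  have ev_out j s' : ev glue (nseq j t) s' =
      match s' with inl i => inl (ev a (nseq j t) i) | inr g => inr g end.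
    elim: j s' => [|j IHj] s' /=.
      by rewrite ev_perm_nil; case: s' => ?; rewrite ?ev_perm_nil.
    rewrite ev_perm_cons; case: s' => s'; last by rewrite glue_out_inr // IHj.
    by rewrite glue_out_inl // IHj ev_perm_cons.
  by rewrite ev_out; case: s => // i; rewrite ev_nseq (valid_order Va zt) perm1.
move=> z w w' zw zw' E; apply/permP=> s.
have [zy|zy] := eqVneq z y.
  rewrite zy in zw zw'; rewrite -(swapK s) !ev_glue_y // E.
  by case: (swap s) => // i; rewrite (Va y _ _ zw zw' E).
have [zx|zx] := eqVneq z x.
  rewrite zx in zw zw'; rewrite !ev_glue_x //; case: s => [i|g].
    by rewrite (Va x _ _ zw zw' E).
  by rewrite !ev_regular (gen1_filter (letters y) E).
have SV := small_valid (gk z) _ zw zw' E.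
case: s => [i|g]; last first.
  by apply: SV; apply: small_le mn _; apply: small_inr.
case: (classic (exists2 v, all (letters z) v &
    exists2 h, h \in shared x y & ev a v i = qa h)) => [[v zv [h hK Eh]]|N].
  have [P [hP Pcl Pm]] := (qa_fresh hK).1.2 z zx.
  have iP : i \in P by apply: (closed_ev Pcl zv); rewrite Eh.
  apply: SV; exists (thick z P); split; rewrite ?mem_thick_inl //.
    by move=> t s; apply: thick_closed.
  apply: leq_trans (card_thick _ _) _; first by rewrite eq_sym.
  by apply: leq_trans mn; rewrite leq_mul2r Pm orbT.
suff off u : all (letters z) u -> ev glue u (inl i) = inl (ev a u i).
  by rewrite !off // (Va z _ _ zw zw' E).
elim/last_ind: u => [|u t IHu]; first by rewrite !ev_perm_nil.
rewrite all_rcons -cats1 => /andP[zt zu].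
rewrite !ev_perm_cat IHu // !ev_perm_cons !ev_perm_nil glue_off // => h hK Eh.
by case: N; exists u => //; exists h.
Qed.

Lemma chain_glue :
  chain_end glue y (shared x y) (inl q) (inl p) (U ++ W) [set inl i | i in I] (m * k.+1).
Proof.
have eN : inl q = swap (inr 1) by rewrite swap_inr // qa1.
split.
- exact: glue_valid.
- move=> w w' yw yw'; rewrite eN !ev_glue_y // !mul1g.
  by move/(can_inj swapK) => -[].
- move=> w yw wK; rewrite eN ev_glue_y // mul1g swap_out //.
  split; last by apply/imsetP=> -[].
  by split=> [t|z]; [apply: glue_out_inr | apply: small_inr].
- have walkW : walk glue [set inl i | i in I] (inl e) W (inl q).
    rewrite /q; elim: (W) (e) xW => [|t w IHw] i /=; first by rewrite ev_perm_nil.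
    case/andP=> xt xw; split; first exact: imset_f.
    by rewrite glue_x_inl // ev_perm_cons; apply: IHw.
  (* The points left along [U] lie in [Y], hence off the overlap, where the glued action agrees with
     the old one. *)
  elim: (U) (p) (ce_walk ceI) => [|t u IHu] i /=; first by move->.
  case=> iY /IHu wu; split; first exact: imset_f.
  rewrite glue_off // => h hK Eh.
  by have := (qa_fresh hK).2; rewrite -Eh iY.
Qed.

End Glue.

(* [W] and the words in [l] are the turns of a path of pieces; no turn may factor
   through the overlaps with the previous and the next piece. *)
Fixpoint nondegenerate x (K : {set G1}) W (l : seq (X * seq T)) : Prop :=
  if l is (y, W') :: l' then
    [/\ x != y, forall h, h \in shared x y -> ev gen1 W * h \notin K
      & nondegenerate y (shared x y) W' l']
  else ev gen1 W \notin K.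

(** The path starts in [Y] and ends in the last piece outside the coset along which that piece was
    glued, where [ce_fresh] excludes [Y]. For nonempty [l], the gluing puts the start into the new
    [Y]. *)
Lemma chain_moves l (I : finType) (a : T -> {perm I}) x K e p U Y m W :
    chain_end a x K e p U Y m -> k <= m -> m * k.+1 ^ size l <= n.+1 ->
    all (letters x) W -> all (fun yw => all (letters yw.1) yw.2) l ->
    nondegenerate x K W l -> (l = [::] -> p \in Y) ->
  exists (I' : finType) (a' : T -> {perm I'}) (p' : I'),
    [/\ valid a', #|I'| = #|I| + size l * #|G1|
      & ev a' (U ++ W ++ flatten (unzip2 l)) p' != p'].
Proof.
elim: l I a x K e p U Y m W => [|[y W'] l IHl] I a x K e p U Y m W /= ceI km mn xW.
  move=> _ WK /(_ erefl) pY; exists I, a, p; split; first exact: ce_valid ceI.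
    by rewrite mul0n addn0.
  have [_ WY] := ce_fresh ceI xW WK.
  rewrite cats0 ev_perm_cat (walk_ev (ce_walk ceI)).
  by apply: contraNneq WY => ->.
case/andP=> yW' lW [xy WK nd] _.
have kp : 0 < k.+1 ^ size l by rewrite expn_gt0.
have mn' : m * k.+1 <= n.+1.
  by apply: leq_trans mn; rewrite expnS mulnA leq_pmulr.
have ce' := chain_glue ceI xy xW WK km mn'.
case: (IHl _ _ _ _ _ _ _ _ _ W' ce') => //.
- by apply: leq_trans km _; rewrite leq_pmulr.
- by rewrite -mulnA -expnS.
- by move=> _; apply: imset_f.
move=> I' [a' [p' [Va' cI' mv]]]; exists I', a', p'; split=> //.
  by rewrite cI' card_sum mulSn addnA.
by rewrite -catA in mv.
Qed.

(** * The second group and its acyclicity *)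

Variable N : nat.

Definition validb (c : {ffun T -> {perm 'I_N.+1}}) : bool :=
  if excluded_middle_informative (valid c) then true else false.

Definition gen2 := universal validb.
Local Notation G2 := {perm ({ffun T -> {perm 'I_N.+1}} * 'I_N.+1)}.

Lemma validbP c : validb c <-> valid c.
Proof. by rewrite /validb; case: excluded_middle_informative. Qed.

Lemma valid_gen2 : valid gen2.
Proof.
move=> z w w' zw zw' E; apply/ev_universalP=> c /validbP Vc.
exact: Vc zw zw' E.
Qed.

Lemma gen2_valid (I : finType) (a : T -> {perm I}) w w' :
  valid a -> #|I| <= N.+1 -> ev gen2 w = ev gen2 w' -> ev a w = ev a w'.
Proof.
move=> Va IN /ev_universalP E.
have [||phi [c [phiI c1 _ c3]]] := @transport T I a predT [set: I] N.
- by move=> *; rewrite inE.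
- by rewrite cardsT.
have evc u j : ev c u (phi j) = phi (ev a u j).
  elim: u j => [|t u IHu] j; first by rewrite !ev_perm_nil.
  by rewrite !ev_perm_cons c1 ?inE // IHu.
have evo u j : j \notin codom phi -> ev c u j = j.
  move=> nj; elim: u => [|t u IHu]; first by rewrite ev_perm_nil.
  rewrite ev_perm_cons c3 // => i _; apply: contraNneq nj => <-.
  exact: codom_f.
apply/permP=> i; apply: phiI; rewrite ?inE // -!evc (E c) //; apply/validbP.
move=> z u u' zu zu' Eu; apply/permP=> j.
have [/codomP[i' ->]|nj] := boolP (j \in codom phi).
  by rewrite !evc (Va z u u').
by rewrite !evo.
Qed.

Lemma gen2_filter (be : pred T) w w' :
  ev gen2 w = ev gen2 w' -> ev gen2 (filter be w) = ev gen2 (filter be w').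
Proof.
move=> /ev_universalP E; apply/ev_universalP=> c /validbP Vc.
pose c' := [ffun t => if be t then c t else 1].
have Ec u : ev c' u = ev c (filter be u).
  by rewrite -ev_restrict; apply: eq_ev => t; rewrite ffunE.
rewrite -!Ec; apply: E; apply/validbP=> z u u' zu zu' Eu; rewrite !Ec.
apply: (Vc z); rewrite ?all_filter; last exact: gen1_filter.
  by apply: sub_all zu => t zt; apply/implyP.
by apply: sub_all zu' => t zt; apply/implyP.
Qed.

(* The path moves the start of the chain, on which [gen2] acts as well. *)
Lemma gen2_acyclic x W l : l != [::] ->
    k * k.+1 ^ size l <= n.+1 -> #|G1| + size l * #|G1| <= N.+1 ->
    all (letters x) W -> all (fun yw => all (letters yw.1) yw.2) l ->
  nondegenerate x set0 W l -> ev gen2 (W ++ flatten (unzip2 l)) != 1.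
Proof.
move=> l0 ln lN xW lW nd.
have [||||||I' [a' [p' [Va' cI' mv]]]] := chain_moves (chain_start x) (l := l) (W := W) => //.
  by move=> El; rewrite El in l0.
apply: contraNneq mv => E; rewrite -(ev_nil gen2) in E.
by rewrite (gen2_valid Va' _ E) ?ev_perm_nil // cI'.
Qed.

(** * Hubs and their orbits *)

Lemma small_act_valid (I : finType) (a : T -> {perm I}) :
  #|I| <= n.+1 -> (forall t, a t ^+ k = 1) -> valid a.
Proof.
move=> In ak z w w' zw zw' E; apply/permP=> i.
apply: (@small_valid I a z i) => //; exists [set: I].
by split; rewrite ?cardsT // => *; rewrite inE.
Qed.

Variables (Q : finType) (aQ : T -> {perm Q}).
Hypothesis aQ_valid : valid aQ.
Hypothesis Q_card : #|Q| <= N.+1.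

Local Notation hub := (G2 * Q)%type.

Definition move w (o : hub) : hub := (o.1 * ev gen2 w, ev aQ w o.2).

Lemma move_nil o : move [::] o = o.
Proof. by case: o => g s; rewrite /move !ev_nil mulg1 perm1. Qed.

Lemma move_cat w w' o : move (w ++ w') o = move w' (move w o).
Proof. by rewrite /move /= !ev_cat mulgA permM. Qed.

(** The action on [Q] factors through [gen2], and the first component of a hub moves regularly, so a
    single hub detects equality of words. *)
Lemma moveP w w' o : move w o = move w' o <-> ev gen2 w = ev gen2 w'.
Proof.
split=> [[/mulgI]|E] //.
by rewrite /move E (gen2_valid aQ_valid Q_card E).
Qed.

Definition step x : rel hub :=
  fun o o' => [exists t, letters x t && (o' == move [:: t] o)].

Definition orb x (o : hub) : {set hub} := [set o' | connect (step x) o o'].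

Lemma orbP x o o' : reflect (exists2 w, all (letters x) w & o' = move w o) (o' \in orb x o).
Proof.
rewrite inE; apply: (iffP connectP) => [[p op ->]|[w xw ->]].
  elim: p o op => [|o1 p IHp] o /=; first by exists [::]; rewrite ?move_nil.
  case/andP=> /existsP[t /andP[xt /eqP->]] /IHp[w xw ->].
  by exists (t :: w); [rewrite /= xt | rewrite -(move_cat [:: t])].
elim: w o xw => [|t w IHw] o /=; first by exists [::]; rewrite ?move_nil.
case/andP=> xt xw; rewrite -cat1s move_cat.
have [p op ->] := IHw (move [:: t] o) xw.
exists (move [:: t] o :: p); rewrite //= op andbT.
by apply/existsP; exists t; rewrite xt eqxx.
Qed.

Lemma orb_refl x o : o \in orb x o.
Proof. by rewrite inE connect0. Qed.

Lemma orb_sym x o o' : o' \in orb x o -> o \in orb x o'.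
Proof.
(* There are no inverse letters: the way back repeats [w] one time less than the order of its
   value. *)
case/orbP=> w xw ->; apply/orbP; pose j := #[ev gen2 w].-1.
exists (flatten (nseq j w)).
  by elim: (j) => //= i IHi; rewrite all_cat xw.
have E : ev gen2 (w ++ flatten (nseq j w)) = ev gen2 [::].
  have Ej i : ev gen2 (flatten (nseq i w)) = ev gen2 w ^+ i.
    by elim: i => [|i IHi] /=; rewrite ?ev_nil // ev_cat IHi expgS.
  by rewrite ev_cat Ej -expgS prednK ?order_gt0 // expg_order ev_nil.
by rewrite -move_cat -{1}[o]move_nil; apply/moveP.
Qed.

Lemma orb_eq x o o' : o' \in orb x o -> orb x o' = orb x o.
Proof.
move=> oo'; have o'o := orb_sym oo'; rewrite !inE in oo' o'o.
by apply/setP=> o''; rewrite !inE; apply/idP/idP; apply: connect_trans.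
Qed.

Local Notation coset := (X * {set hub})%type.

Definition at_hub (c : coset) o := c.2 == orb c.1 o.

Definition meet : rel coset := fun c d => [exists o, at_hub c o && at_hub d o].

Lemma meetP c d : reflect (exists2 o, at_hub c o & at_hub d o) (meet c d).
Proof.
by apply: (iffP existsP) => [[o /andP[]]|[o co do_]]; exists o; rewrite ?co.
Qed.

Lemma meet_sym : symmetric meet.
Proof. by move=> c d; apply: eq_existsb => o; rewrite andbC. Qed.

Lemma at_hub_move (c : coset) o w : at_hub c o -> all (letters c.1) w -> at_hub c (move w o).
Proof.
by move=> /eqP co cw; apply/eqP; rewrite co [RHS](@orb_eq _ o) //; apply/orbP; exists w.
Qed.

Lemma at_hub_conn (c : coset) o o' : at_hub c o -> at_hub c o' ->
  exists2 w, all (letters c.1) w & o' = move w o.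
Proof. by move=> /eqP co /eqP co'; apply/orbP; rewrite -co co' orb_refl. Qed.

Lemma at_hub_neq (c d : coset) o : c != d -> at_hub c o -> at_hub d o -> c.1 != d.1.
Proof.
move=> cd /eqP co /eqP do_; apply: contraNneq cd => E.
by rewrite [c]surjective_pairing co E -do_ -surjective_pairing.
Qed.

(** The words along [c] and along [d] have the same value; killing the letters outside [d] keeps the
    second and makes the first a word of shared letters. *)
Lemma at_hub2 (c d : coset) o o' : c != d ->
    at_hub c o -> at_hub d o -> at_hub c o' -> at_hub d o' ->
  exists2 w, all (both c.1 d.1) w & o' = move w o.
Proof.
move=> cd co do_ co' do'; have [w cw Ew] := at_hub_conn co co'.
have [v dv Ev] := at_hub_conn do_ do'.
exists (filter (letters d.1) w); first exact: all_both.
rewrite Ev; apply/moveP; rewrite -{1}(all_filterP dv); apply: gen2_filter.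
by apply/(moveP _ _ o); rewrite -Ev.
Qed.

Lemma at_hub2_eq (c d : coset) o o' : c != d ->
    at_hub c o -> at_hub d o -> at_hub c o' -> at_hub d o' ->
  (forall t, ~~ both c.1 d.1 t) -> o = o'.
Proof.
move=> cd co do_ co' do' nb; have [w cdw ->] := at_hub2 cd co do_ co' do'.
case: w cdw => [|t w] /=; first by rewrite move_nil.
by rewrite (negPf (nb t)).
Qed.

Lemma filter_both_distinct (c d e : coset) o o' o'' w : c != d -> e != c -> e != d ->
    at_hub c o -> at_hub d o -> at_hub c o' -> at_hub e o' ->
    at_hub d o'' -> at_hub e o'' ->
  all (both c.1 d.1) w -> filter (letters e.1) w = [::].
Proof.
move=> cd ec ed co do_ co' eo' do'' eo''; apply: filter_triple.
- exact: at_hub_neq co do_.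
- exact: at_hub_neq ec eo' co'.
- exact: at_hub_neq ed eo'' do''.
Qed.

Lemma at_hub4 (c d e f : coset) o o1 o2 : c != d -> e != c -> e != d ->
    f != c -> f != d -> f != e ->
    at_hub c o -> at_hub d o -> at_hub e o ->
    at_hub d o1 -> at_hub e o1 -> at_hub f o1 ->
    at_hub c o2 -> at_hub e o2 -> at_hub f o2 -> at_hub f o.
Proof.
move=> cd ec ed fc fd fe co do_ eo do1 eo1 fo1 co2 eo2 fo2.
have de : d != e by rewrite eq_sym.
have ce : c != e by rewrite eq_sym.
have [u du Eu] := at_hub2 de do_ eo do1 eo1.
have ef : e != f by rewrite eq_sym.
have [v ev' Ev] := at_hub2 ef eo1 fo1 eo2 fo2.
have [w cw Ew] := at_hub2 ce co eo co2 eo2.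
have dc : d != c by rewrite eq_sym.
have df : d != f by rewrite eq_sym.
have Fv := filter_both_distinct ef de df eo1 fo1 eo do_ fo1 do1 ev'.
have Fw := filter_both_distinct ce dc de co eo co do_ eo do_ cw.
have /gen2_filter-/(_ (letters d.1)) : ev gen2 (u ++ v) = ev gen2 w.
  by apply/(moveP _ _ o); rewrite move_cat -Eu -Ev -Ew.
rewrite filter_cat Fv Fw cats0 (all_filterP (all_bothl du)) => /moveP-/(_ o).
by rewrite move_nil -Eu => <-.
Qed.

Definition triple (s : seq coset) := exists s1 a b c s2,
  s = s1 ++ [:: a, b, c & s2] /\ exists o, [/\ at_hub a o, at_hub b o & at_hub c o].

Lemma triple_cons a s : triple s -> triple (a :: s).
Proof. by case=> s1 [b [c [d [s2 [-> H]]]]]; exists (a :: s1), b, c, d, s2. Qed.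

(** A degenerate turn is a relation of [gen1] among letters at [c], hence one of [gen2]: a word
    shared with [d] from [o'] and a word shared with [b] from [o] lead to the same hub. *)
Lemma degenerate_hub (b c d : coset) o o' W h :
    at_hub b o -> at_hub c o -> at_hub d o' -> o' = move W o ->
    all (letters c.1) W -> h \in shared c.1 d.1 -> ev gen1 W * h \in shared b.1 c.1 ->
  exists o'', [/\ at_hub b o'', at_hub c o'' & at_hub d o''].
Proof.
move=> bo co do' Eo' cW /shared_word[v cdv <-] /shared_word[u bcu].
rewrite -ev_cat => /esym E; exists (move v o').
have Eu : move v o' = move u o.
  rewrite Eo' -move_cat; apply/moveP; apply: (valid_gen2 (z := c.1)) E.
    by rewrite all_cat cW (all_bothl cdv).
  exact: all_bothr bcu.
split; rewrite ?Eu; first by rewrite at_hub_move ?(all_bothl bcu).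
  by rewrite at_hub_move ?(all_bothr bcu).
by rewrite -Eu at_hub_move ?(all_bothr cdv).
Qed.

Let adjacent := fun c d => (c != d) && meet c d.

Lemma cycle_words s c0 b c o : b != c -> at_hub b o -> at_hub c o ->
    path adjacent c (rcons s c0) -> ~ triple (b :: c :: rcons s c0) ->
  exists W l, [/\ all (letters c.1) W, all (fun yw => all (letters yw.1) yw.2) l,
    size l = size s, nondegenerate c.1 (shared b.1 c.1) W l
    & at_hub (last c s) (move (W ++ flatten (unzip2 l)) o) /\
      at_hub c0 (move (W ++ flatten (unzip2 l)) o)].
Proof.
elim: s b c o => [|d s IHs] b c o bc bo co /=.
  rewrite andbT => /andP[cd /meetP[o' co' do']] nt.
  have [W cW Eo'] := at_hub_conn co co'.
  exists W, [::]; rewrite /= cats0 -Eo'; split=> //.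
  apply/negP=> WK; case: nt; exists [::], b, c, c0, [::]; split=> //.
  by apply: (degenerate_hub bo co do' Eo' cW (group1 _)); rewrite mulg1.
case/andP=> /andP[cd /meetP[o' co' do']] ds nt.
have [W cW Eo'] := at_hub_conn co co'.
have [|W' [l [dW' lW sl nd [lo c0o]]]] := IHs c d o' cd co' do' ds.
  by move/(triple_cons b).
exists W, ((d.1, W') :: l); rewrite /= dW' sl; split=> //.
  split=> //; first exact: at_hub_neq cd co' do'.
  move=> h hK; apply/negP=> WK; case: nt; exists [::], b, c, d, (rcons s c0).
  by split=> //; exact: (degenerate_hub bo co do' Eo' cW hK WK).
by rewrite move_cat -Eo'.
Qed.

(** Without a triple, the turns of the cycle closed up at [c0] form a nondegenerate path of value 1,
    against [gen2_acyclic]. The turn [W0] comes first, with no earlier piece, hence [set0]. *)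
Lemma cycle_triple s c0 : s != [::] ->
    k * k.+1 ^ size s <= n.+1 -> #|G1| + size s * #|G1| <= N.+1 ->
  path adjacent c0 (rcons s c0) -> triple (c0 :: rcons s c0).
Proof.
case: s => // c s _ ln lN /= /andP[/andP[bc /meetP[o bo co]] cs].
apply: NNPP => nt; have [W [l [cW lW sl nd [lo c0o]]]] := cycle_words bc bo co cs nt.
have [W0 bW0 Eo] := at_hub_conn c0o bo.
have nd0 : nondegenerate c0.1 set0 W0 ((c.1, W) :: l).
  by split=> //; [apply: at_hub_neq bc bo co | move=> h _; rewrite inE].
suff /eqP E : ev gen2 (W0 ++ W ++ flatten (unzip2 l)) = 1.
  have := @gen2_acyclic c0.1 W0 ((c.1, W) :: l); rewrite E /= sl cW.
  by move=> /(_ isT ln lN bW0 lW nd0).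
set o' := move _ o in Eo; rewrite -(ev_nil gen2).
by apply/(moveP _ _ o'); rewrite move_nil move_cat -Eo.
Qed.

Variable L : nat.
(** Room for a chain of [L] gluings: [n] bounds its small orbits, [N] the number of its points. *)
Hypothesis Ln : k * k.+1 ^ L <= n.+1.
Hypothesis LN : #|G1| + L * #|G1| <= N.+1.

Lemma cycle_triple_le s c0 : s != [::] -> size s <= L ->
  path adjacent c0 (rcons s c0) -> triple (c0 :: rcons s c0).
Proof.
move=> s0 sL; apply: cycle_triple => //.
  by apply: leq_trans Ln; rewrite leq_mul2l leq_exp2l ?sL ?orbT.
by apply: leq_trans LN; rewrite leq_add2l leq_mul2r sL orbT.
Qed.

(** A common hub of three consecutive orbits on the cycle gives a chord past the middle one.
    Dropping that orbit shortens [s], until one meeting both [d1] and [d] appears. *)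
Lemma fan d d1 s : d1 != d -> meet d d1 -> s != [::] -> size s < L ->
    uniq (d1 :: rcons s d) -> path meet d1 (rcons s d) ->
  exists2 r, r \in s & meet d1 r && meet r d.
Proof.
move=> d1d dd1; have [m] := ubnP (size s).
elim: m s => // m IHm s sm s0 sL us ps.
have ne x t : uniq (x :: t) -> path meet x t -> path adjacent x t.
  elim: t x => //= y t IHt x /andP[xt yt] /andP[xy ty].
  rewrite {1}/adjacent xy IHt // !andbT.
  by apply: contraNneq xt => ->; rewrite inE eqxx.
have [|s1 [a [b [c [s2 [Es [o [ao bo co]]]]]]]] := @cycle_triple_le (d1 :: s) d isT sL.
  by rewrite rcons_cons /= ne // andbT /adjacent eq_sym d1d dd1.
have ac : meet a c by apply/meetP; exists o.
have IH s' : subseq s' s -> size s' < size s -> s' != [::] ->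
    path meet d1 (rcons s' d) -> exists2 r, r \in s & meet d1 r && meet r d.
  move=> sub lt s'0 ps'; case: (IHm s' (leq_trans lt sm)) => //.
  - exact: ltn_trans sL.
  - apply: subseq_uniq us; rewrite -!cats1 -!cat_cons; by apply: cat_subseq; rewrite /= eqxx.
  - by move=> r rs' H; exists r => //; apply: mem_subseq rs'.
case: s1 Es => [|d' s1] /=; last case=> _ Es.
  case=> Ed _; case: s s0 ps {sm sL us IH} => //= p s _ /andP[d1p _] [Ep _].
  by exists p; rewrite ?mem_head // d1p meet_sym Ep Ed.
case: s1 Es => [|d1' s1] /= Es.
  case: Es => Ea; case: s s0 ps sm sL us IH => //= p s _ /andP[d1p ps] sm sL us IH [Ep Es].
  case: s Es ps sm sL us IH => [|p' s] /= Es ps sm sL us IH.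
    by exists p; rewrite ?mem_head // d1p; case/andP: ps.
  apply: (IH (p' :: s)) => //; first exact: (subseq_cons (p' :: s) p).
  rewrite rcons_cons /=; case/andP: ps => _ ->.
  by case: Es => -> _; rewrite Ea ac.
case: Es => _; case/lastP: s2 => [|s2 e] Es.
  have [Es' Ec] : (s, d) = (s1 ++ [:: a; b], c).
    by apply: rcons_inj; rewrite Es rcons_cat.
  apply: (IH (s1 ++ [:: a])).
  - by rewrite Es' cat_subseq //= eqxx.
  - by rewrite Es' !size_cat ltn_add2l.
  - by case: (s1).
  move: ps; rewrite Es cats1 -!cats1 -catA !cat_path /= Ec ac.
  by case/and4P=> -> -> _ _.
have [Es' Ec] : (s, d) = (s1 ++ [:: a, b, c & s2], e).
  by apply: rcons_inj; rewrite Es rcons_cat.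
apply: (IH (s1 ++ [:: a, c & s2])).
- rewrite Es' cat_subseq // -[a :: b :: _]/([:: a] ++ _) -[a :: c :: _]/([:: a] ++ _).
  by rewrite cat_subseq // (subseq_cons _ b).
- by rewrite Es' !size_cat ltn_add2l.
- by case: (s1).
move: ps; rewrite Es rcons_cat !cat_path /= -Ec ac.
by case/andP=> -> /and4P[-> _ _ ->].
Qed.

(** * Graphs without small cuts at a single hub *)

Section CommonHub.
Variables (G : sgraph) (phi : G -> coset).
Hypothesis phi_inj : injective phi.
Hypothesis edge_meet : forall x y, edge x y -> meet (phi x) (phi y).
Hypothesis meet_edge : forall x y o, x != y -> at_hub (phi x) o ->
  at_hub (phi y) o -> (exists t, both (phi x).1 (phi y).1 t) -> edge x y.
Hypothesis G_connected : connected G.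
Hypothesis G_no_cut_vertex : ~ has_cut_vertex G.
Hypothesis G_no_adjacent_cut : ~ has_adjacent_two_vertex_cut G.
Hypothesis G_card : #|G| < L.

Let meetG (x y : G) := meet (phi x) (phi y).
Let D o := [set x | at_hub (phi x) o].

Lemma fanG o (d1 d2 : G) s : d1 \in D o -> d2 \in D o -> d1 != d2 ->
    s != [::] -> uniq s -> all [predC D o] s -> path meetG d1 (rcons s d2) ->
  exists2 r, r \in s & meetG d1 r && meetG r d2.
Proof.
rewrite !inE => do1 do2 d12 s0 us sD ps.
have [||||||_ /mapP[r rs ->] H] := @fan (phi d2) (phi d1) (map phi s).
- by rewrite (inj_eq phi_inj).
- by apply/meetP; exists o.
- by case: (s) s0.
- rewrite size_map; apply: leq_ltn_trans G_card.
  by rewrite -(card_uniqP us) max_card.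
- rewrite -map_rcons -map_cons (map_inj_uniq phi_inj) /= rcons_uniq us andbT.
  rewrite mem_rcons inE negb_or d12 /=; apply/andP; split.
    by apply/negP=> /(allP sD); rewrite /= inE do1.
  by apply/negP=> /(allP sD); rewrite /= inE do2.
- by rewrite -map_rcons path_map.
by exists r.
Qed.

(** The cycle [z], [x], [y], [z] has only two runs of three consecutive entries, and both consist of
    [x], [y] and [z]. *)
Lemma triple_hub (x y z : G) : x != y -> z != x -> z != y ->
    meetG x y -> meetG x z -> meetG y z ->
  exists o, [/\ x \in D o, y \in D o & z \in D o].
Proof.
move=> xy zx zy mxy mxz myz.
have L2 : 1 < L.
  by apply: leq_trans G_card; apply/ltnW; apply/card_gt1P; exists x, y.
have [|||s1 [a [b [c [s2 [Es [o [ao bo co]]]]]]]] :=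
    @cycle_triple_le [:: phi x; phi y] (phi z).
- by [].
- by [].
- rewrite /= /adjacent !(inj_eq phi_inj) zx xy [y == z]eq_sym zy.
  by rewrite -!/(meetG _ _) mxy myz /meetG meet_sym -/(meetG _ _) mxz.
have ex p q r (E : [:: a; b; c] = [:: phi p; phi q; phi r]) :
    [/\ p \in D o, q \in D o & r \in D o].
  by case: E ao bo co => -> -> -> *; split; rewrite inE.
exists o; case: s1 Es => [|? [|? s1]] Es; last first.
- by have := congr1 size Es; rewrite /= size_cat /= !addnS.
- by case: Es => _ Ea Eb Ec _; have [] := ex x y z; rewrite ?Ea ?Eb ?Ec.
- by case: Es => Ea Eb Ec _; have [] := ex z x y; rewrite ?Ea ?Eb ?Ec.
Qed.

(* At a hub with the largest set [D o], the neighbours of a component [R] outside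
   [D o] are pairwise adjacent and at most two in number, hence they cut [G]. *)
Lemma common_hub : (exists x y : G, edge x y) -> exists o, forall x, at_hub (phi x) o.
Proof.
case=> x0 [y0 xy0]; have /meetP[o0 x0o y0o] := edge_meet xy0.
pose o := [arg max_(o > o0) #|D o|].
have max_o o' : #|D o'| <= #|D o|.
  by rewrite /o; case: arg_maxnP => // o1 _; apply.
have D2 : 1 < #|D o|.
  apply: leq_trans (max_o o0); apply/card_gt1P; exists x0, y0; split.
  - by rewrite inE.
  - by rewrite inE.
  - by apply: contraTneq xy0 => ->; rewrite edge_irrefl.
have [DT|] := boolP [forall x, at_hub (phi x) o]; first by exists o; apply/forallP.
case/forallPn=> r0 r0o; exfalso.
pose eR (x y : G) := [&& edge x y, x \notin D o & y \notin D o].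
have eR_sym : connect_sym eR.
  apply: sym_connect_sym => x y; rewrite /eR edge_sym.
  by congr (_ && _); apply: andbC.
pose R := [set x | connect eR r0 x].
have r0R : r0 \in R by rewrite inE connect0.
have RD x : x \in R -> x \notin D o.
  rewrite inE => /connectP[p]; case/lastP: p => [_ ->|p y]; first by rewrite inE.
  by rewrite last_rcons rcons_path => /andP[_ /and3P[_ _ yD]] ->.
have R_path x y : x \in R -> y \in R -> exists p,
    [/\ path eR x p, y = last x p, uniq (x :: p) & all (mem R) (x :: p)].
  move=> xR yR; have : connect eR x y.
    by move: xR yR; rewrite !inE => xr; apply: connect_trans; rewrite eR_sym.
  case/connectP=> p0 xp0 ->; case: (shortenP xp0) => p xp up _.
  exists p; split=> //; apply/allP=> z zp; rewrite !inE in xR *.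
  by apply: connect_trans xR _; apply: (path_connect xp).
pose N' := [set d in D o | [exists r in R, edge d r]].
have R_closed x y : x \in R -> edge x y -> y \notin N' -> y \in R.
  move=> xR xy yN; have xD := RD x xR.
  have yD : y \notin D o.
    apply: contra yN => yD; rewrite inE yD; apply/exists_inP; exists x => //.
    by rewrite edge_sym.
  rewrite !inE in xR *; apply: connect_trans xR _; apply: connect1.
  by rewrite /eR xy xD.
have meet_path x p : path eR x p -> path meetG x p.
  by apply: sub_path => y z /and3P[/edge_meet].
have Rneq d r : d \in D o -> r \in R -> r != d.
  by move=> dD /RD; apply: contraNneq => ->.
have pair_fan d1 d2 : d1 \in N' -> d2 \in N' -> d1 != d2 ->
    exists2 r, r \in R & meetG d1 r && meetG r d2.
  case/setIdP=> d1D /exists_inP[r1 r1R d1r1] /setIdP[d2D /exists_inP[r2 r2R d2r2]] d12.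
  have [p [r1p Er2 up pR]] := R_path r1 r2 r1R r2R.
  have [||r rp H] := @fanG o d1 d2 (r1 :: p) d1D d2D d12 isT up.
  - by apply: sub_all pR => z; apply: RD.
  - rewrite rcons_cons /= rcons_path -Er2 meet_path // {1}/meetG edge_meet //.
    by rewrite /meetG edge_meet // edge_sym.
  by exists r => //; apply: (allP pR).
have pair_hub d1 d2 : d1 \in N' -> d2 \in N' -> d1 != d2 ->
    exists r o', [/\ r \in R, d1 \in D o', d2 \in D o' & r \in D o'].
  move=> d1N d2N d12; have [r rR /andP[d1r rd2]] := pair_fan d1 d2 d1N d2N d12.
  have [d1D _] := setIdP d1N; have [d2D _] := setIdP d2N.
  have [|||||o' [d1o d2o ro]] := @triple_hub d1 d2 r d12.
  - exact: Rneq.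
  - exact: Rneq.
  - by apply/meetP; exists o; [have := d1D | have := d2D]; rewrite inE.
  - by [].
  - by rewrite /meetG meet_sym.
  by exists r, o'.
(* Without a shared letter the two orbits would meet in one hub only, so [o = o'] and [r] would lie
   in [D o]. *)
have pair_edge d1 d2 : d1 \in N' -> d2 \in N' -> d1 != d2 -> edge d1 d2.
  move=> d1N d2N d12; have [r [o' [rR d1o' d2o' ro']]] := pair_hub d1 d2 d1N d2N d12.
  have [d1D _] := setIdP d1N; have [d2D _] := setIdP d2N.
  move: d1D d2D d1o' d2o' ro'; rewrite !inE => d1D d2D d1o' d2o' ro'.
  have phi12 : phi d1 != phi d2 by rewrite (inj_eq phi_inj).
  case: (pickP (both (phi d1).1 (phi d2).1)) => [t tb|nb].
    by apply: meet_edge d12 d1D d2D _; exists t.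
  have E : o = o' by apply: (at_hub2_eq phi12) => // t; rewrite nb.
  by have := RD r rR; rewrite inE E ro'.
(* Let [x] be the first vertex meeting [d3] on a path in [R] from some [r] that meets [d1] and [d2].
   By [fanG], [d1] and [d2] also meet [x], and [at_hub4] then puts [x] into [D o], although it lies
   in [R]. *)
have no3 d1 d2 d3 : d1 \in N' -> d2 \in N' -> d3 \in N' ->
    d1 != d2 -> d3 != d1 -> d3 != d2 -> False.
  move=> d1N d2N d3N d12 d31 d32.
  have [d1D _] := setIdP d1N; have [d2D _] := setIdP d2N.
  have [d3D /exists_inP[r3 r3R dr3]] := setIdP d3N.
  have [r rR /andP[d1r rd2]] := pair_fan d1 d2 d1N d2N d12.
  have [p [rp Er3 up pR]] := R_path r r3 rR r3R.
  have has3 : has (meetG^~ d3) (r :: p).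
    apply/hasP; exists r3; first by rewrite Er3 mem_last.
    by rewrite /meetG edge_meet // edge_sym.
  have [s1 [x [s2 [Es x3 s1N]]]] : exists s1 x s2,
      [/\ r :: p = rcons s1 x ++ s2, meetG x d3 & ~~ has (meetG^~ d3) s1].
    by case: (split_find has3) => x s1 s2 x3 s1N; exists s1, x, s2.
  have inR z : z \in rcons s1 x -> z \in R.
    by move=> zs; apply: (allP pR); rewrite Es mem_cat zs.
  have only_x d : d \in D o -> meetG d r -> d != d3 -> meetG d x.
    move=> dD dr dd3; have [||||r' r's /andP[dr' r'3]] := @fanG o d d3 (rcons s1 x) dD d3D dd3.
    - by case: (s1).
    - by move: up; rewrite Es cat_uniq => /andP[].
    - by apply/allP=> z /inR /RD.
    - rewrite rcons_path last_rcons x3 andbT.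
      have : path meetG d (r :: p) by rewrite /= dr meet_path.
      by rewrite Es cat_path => /andP[].
    move: r's; rewrite mem_rcons inE => /predU1P[<- //|r's1].
    by case/hasP: s1N; exists r'.
  have xR : x \in R by apply: inR; rewrite mem_rcons mem_head.
  have d13 : d1 != d3 by rewrite eq_sym.
  have d23 : d2 != d3 by rewrite eq_sym.
  have d1x := only_x d1 d1D d1r d13.
  have d2x : meetG d2 x by apply: only_x => //; rewrite /meetG meet_sym.
  have d3x : meetG d3 x by rewrite /meetG meet_sym.
  have meetD d d' : d \in D o -> d' \in D o -> meetG d d'.
    by rewrite !inE => dD d'D; apply/meetP; exists o.
  have [o1 []] := triple_hub d23 (Rneq _ _ d2D xR) (Rneq _ _ d3D xR)
                    (meetD _ _ d2D d3D) d2x d3x.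
  have [o2 []] := triple_hub d13 (Rneq _ _ d1D xR) (Rneq _ _ d3D xR)
                    (meetD _ _ d1D d3D) d1x d3x.
  have := RD x xR; move: (d1D) (d2D) (d3D); rewrite !inE.
  move=> d1o d2o d3o /negP xo d1o2 d3o2 xo2 d2o1 d3o1 xo1; apply: xo.
  apply: (@at_hub4 (phi d1) (phi d2) (phi d3) (phi x) o o1 o2) => //;
    by rewrite (inj_eq phi_inj) // Rneq.
have DN d d' : d \in D o -> d \notin N' -> d' \in N' -> N' = [set d'] -> False.
  move=> dD dN _ EN; apply: G_no_cut_vertex; exists d'.
  have d'D : d' \in D o by have := set11 d'; rewrite -EN => /setIdP[].
  rewrite -EN; apply: (closed_vertex_cut (R := R) (x := r0) (y := d)) => //.
  - by apply: contra (RD r0 r0R) => /setIdP[].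
  - by apply/negP=> /RD; rewrite dD.
have [N0|[d1 d1N]] := set_0Vmem N'.
  have [d dD] : exists d, d \in D o by apply/card_gt0P; apply: ltnW.
  have dR : d \in R.
    apply: (closed_connected _ G_connected _ r0R) => a b aR ab.
    by apply: R_closed aR ab _; rewrite N0 inE.
  by have := RD d dR; rewrite dD.
have d1D : d1 \in D o by case/setIdP: d1N.
have [d dD dd1] : exists2 d, d \in D o & d != d1.
  have [x [y [xD yD xy]]] := card_gt1P D2.
  by have [E|] := eqVneq x d1; [exists y; rewrite // -E eq_sym | exists x].
have [EN|] := eqVneq N' [set d1].
  by apply: (DN d d1) => //; rewrite EN inE.
rewrite eqEsubset sub1set d1N andbT => /subsetPn[d2 d2N]; rewrite inE => d21.
have d12 : d1 != d2 by rewrite eq_sym.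
have EN : N' = [set d1; d2].
  apply/eqP; rewrite eqEsubset subUset !sub1set d1N d2N !andbT.
  apply/subsetP=> d3 d3N; rewrite !inE; apply: contraT; rewrite negb_or.
  by case/andP=> d31 d32; case: (no3 d1 d2 d3).
have d2D : d2 \in D o by case/setIdP: d2N.
(* If [D o] had only the elements [d1] and [d2], the hub [o'], which also carries [r], would beat
   the maximal [o]. *)
have [/subsetP DsubN|/subsetPn[d3 d3D d3N]] := boolP (D o \subset N').
  have [r [o' [rR d1o' d2o' ro']]] := pair_hub d1 d2 d1N d2N d12.
  have : 2 < #|D o'|.
    apply/card_gt2P; exists d1, d2, r; split=> //.
    by rewrite d12 [d2 == r]eq_sym !Rneq.
  rewrite ltnNge => /negP[]; apply: leq_trans (max_o o') _.
  have <- : #|N'| = 2 by rewrite EN cards2 d12.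
  by apply/subset_leq_card/subsetP.
apply: G_no_adjacent_cut; exists d1, d2; split; first exact: pair_edge.
rewrite -EN; apply: (closed_vertex_cut (R := R) (x := r0) (y := d3)) => //.
- by apply: contra (RD r0 r0R) => /setIdP[].
- by apply/negP=> /RD; rewrite d3D.
Qed.

End CommonHub.

End Acyclic.

(** * Induced copies as embeddings *)

Definition embedding (K G : sgraph) (f : K -> G) :=
  injective f /\ forall x y, edge (f x) (f y) = edge x y.

Lemma contains_inducedP (G K : sgraph) :
  contains_induced G K <-> exists f : K -> G, embedding f.
Proof.
split=> [[S [f [g fK gK] fE]]|[f [f_inj fE]]].
  exists (val \o g); split; first exact: inj_comp val_inj (can_inj gK).
  by move=> x y; rewrite -[RHS](congr2 _ (gK x) (gK y)) fE.
have fS x : f x \in f @: [set: K] by apply: imset_f; rewrite inE.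
pose f' x : induced (f @: [set: K]) := Sub (f x) (fS x).
have f'_inj : injective f' by move=> x y /(congr1 val) /f_inj.
have surj y : exists x, f' x == y.
  have /imsetP[x _ Ex] := valP y; exists x; apply/eqP/val_inj.
  exact: esym Ex.
pose g y := xchoose (surj y).
have gK : cancel g f' by move=> y; apply/eqP/(xchooseP (surj y)).
exists (f @: [set: K]); exists g.
  by exists f' => // x; apply: f'_inj; rewrite gK.
by move=> x y; rewrite -fE -[in RHS](gK x) -[in RHS](gK y).
Qed.

Lemma perm_pair (T : finType) (x y p q : T) : x != y -> p != q ->
  exists f : {perm T}, f x = p /\ f y = q.
Proof.
move=> xy pq; exists (tperm x p * tperm (tperm x p y) q).
rewrite !permM tpermL; split; last exact: tpermL.
apply: tpermD; last by rewrite eq_sym.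
by apply: contraNneq xy => E; apply/eqP/(@perm_inj _ (tperm x p)); rewrite tpermL.
Qed.

(** * The host *)

Section Host.
Variables (A : sgraph) (u v : A).
Hypothesis uv : edge u v.

Local Notation X := {ffun A * A -> A}.

(* Permuting the values coordinatewise makes this graph edge-transitive. *)
Definition differ : rel X := fun x y => (x != y) && [forall d, x d != y d].

Lemma differ_sym : symmetric differ.
Proof.
by move=> x y; rewrite /differ eq_sym; congr (_ && _); apply: eq_forallb => d; rewrite eq_sym.
Qed.

Lemma differ_irrefl : irreflexive differ.
Proof. by move=> x; rewrite /differ eqxx. Qed.

Local Notation Q := {ffun A -> X}.

Definition page (s : Q) : bool :=
  injectiveb s && [forall a, forall b, differ (s a) (s b) == edge a b].

Lemma pageP (s : Q) :
  reflect (injective s /\ forall a b, differ (s a) (s b) = edge a b) (page s).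
Proof.
apply: (iffP andP) => [[/injectiveP si /forallP sE]|[si sE]]; split=> //.
- by move=> a b; have /forallP/(_ b)/eqP := sE a.
- exact/injectiveP.
- by apply/forallP=> a; apply/forallP=> b; rewrite sE.
Qed.

(* The coordinate (a, b) of a nonadjacent pair identifies a with b and keeps all
   the other vertices apart, so it destroys exactly the adjacency of a and b. *)
Definition base_page : Q := [ffun a => [ffun d : A * A =>
  if [&& d.1 != d.2, ~~ edge d.1 d.2 & a == d.2] then d.1 else a]].

Lemma page_base : page base_page.
Proof.
(* The coordinate [(u, u)] is the identity of [A], since its two entries coincide. *)
apply/pageP; split=> [a b /ffunP/(_ (u, u))|a b].
  by rewrite !ffunE /= eqxx.
rewrite /differ; apply/andP/idP=> [[ab /forallP dab]|ab].
  apply: contraT => nab; have := dab (a, b); rewrite !ffunE /= nab eqxx andbT.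
  have [E|ab'] := eqVneq a b; first by rewrite E eqxx in ab.
  by rewrite eqxx.
have aDb : a != b by apply: contraTneq ab => ->; rewrite edge_irrefl.
have dab d : base_page a d != base_page b d.
  rewrite !ffunE; case: d => c d /=.
  have [->|cd] //= := eqVneq c d; have [|ncd] //= := boolP (edge c d).
  have [Ead|ad] := eqVneq a d; have [Ebd|bd] := eqVneq b d => //.
  - by rewrite Ead Ebd eqxx in aDb.
  - by apply: contraNneq ncd => ->; rewrite -Ead edge_sym.
  - by apply: contraNneq ncd => <-; rewrite -Ebd.
split; last exact/forallP.
by apply: contraNneq (dab (u, u)) => ->.
Qed.

Lemma page_through x y : differ x y -> exists s, [/\ page s, s u = x & s v = y].
Proof.
case/andP=> _ /forallP xy; have /pageP[si sE] := page_base.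
have /andP[_ /forallP s_uv] : differ (base_page u) (base_page v) by rewrite sE.
have Pd d : exists f : {perm A}, (f (base_page u d) == x d) && (f (base_page v d) == y d).
  by have [f [E1 E2]] := perm_pair (s_uv d) (xy d); exists f; rewrite E1 E2 !eqxx.
pose f d := xchoose (Pd d); have fP d := xchooseP (Pd d).
pose s : Q := [ffun a => [ffun d => f d (base_page a d)]].
have sd a d : s a d = f d (base_page a d) by rewrite [s a]ffunE [LHS]ffunE.
have s_eq a b : (s a == s b) = (base_page a == base_page b).
  apply/eqP/eqP=> E; apply/ffunP=> d; last by rewrite !sd E.
  by apply: (@perm_inj _ (f d)); rewrite -!sd E.
exists s; split.
- apply/pageP; split=> [a b /eqP|a b]; first by rewrite s_eq => /eqP/si.
  rewrite -sE /differ s_eq; congr (_ && _).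
  by apply: eq_forallb => d; rewrite !sd (inj_eq perm_inj).
- by apply/ffunP=> d; rewrite sd; have /andP[/eqP] := fP d.
- by apply/ffunP=> d; rewrite sd; have /andP[_ /eqP] := fP d.
Qed.

Local Notation T := {set X}.

(* [rotate t] runs cyclically through the pages containing both ends of [t]. *)
Definition pages (t : T) : seq Q := [seq s <- enum Q | page s && (t \subset codom s)].

Lemma next_pages_inj t : injective (next (pages t)).
Proof. exact: can_inj (prev_next (filter_uniq _ (enum_uniq _))). Qed.

Definition rotate t : {perm Q} := perm (@next_pages_inj t).

Lemma mem_pages t s : (s \in pages t) = page s && (t \subset codom s).
Proof. by rewrite mem_filter mem_enum andbT. Qed.

Lemma rotate_connect t s s' : s \in pages t -> s' \in pages t ->
  exists j, ev rotate (nseq j t) s = s'.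
Proof.
move=> st s't; have up := filter_uniq _ (enum_uniq Q) : uniq (pages t).
have : fconnect (next (pages t)) s s' by rewrite (fconnect_cycle (cycle_next up)).
move/iter_findex=> <-; exists (findex (next (pages t)) s s').
by rewrite ev_nseq permX; apply: eq_iter => z; rewrite permE.
Qed.

Definition incident x : pred T := [pred t : T | [exists y, differ x y && (t == [set x; y])]].

Lemma incidentP x y (t : T) : x != y -> incident x t -> y \in t ->
  t = [set x; y] /\ differ x y.
Proof.
move=> xy /existsP[z /andP[xz /eqP->]]; rewrite !inE eq_sym (negPf xy).
by move/eqP->.
Qed.

Lemma incident_mem x (t : T) : incident x t -> x \in t.
Proof. by case/existsP=> z /andP[_ /eqP->]; rewrite set21. Qed.

Lemma incident_pair x y t t' : x != y ->
  incident x t -> incident y t -> incident x t' -> incident y t' -> t = t'.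
Proof.
move=> xy xt /incident_mem yt xt' /incident_mem yt'.
by rewrite (incidentP xy xt yt).1 (incidentP xy xt' yt').1.
Qed.

Lemma incident_triple x y z t : x != y ->
  incident x t -> incident y t -> incident z t -> z = x \/ z = y.
Proof.
move=> xy xt /incident_mem yt /incident_mem.
by rewrite (incidentP xy xt yt).1 !inE => /orP[]/eqP->; [left|right].
Qed.

(** Off [pages t] the map [next] is the identity, and every page in [pages t] contains the end [x]
    of [t]. *)
Lemma rotate_live x w (s : Q) : all (incident x) w -> page s -> x \in codom s ->
  page (ev rotate w s) /\ x \in codom (ev rotate w s).
Proof.
elim: w s => [|t w IHw] s /=; first by rewrite ev_perm_nil.
case/andP=> xt xw ps xs; rewrite ev_perm_cons; apply: IHw => //.
  have [st|st] := boolP (s \in pages t); rewrite permE; last by rewrite next_nth (negPf st).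
  by have : next (pages t) s \in pages t; [rewrite mem_next | rewrite mem_pages => /andP[]].
have [st|st] := boolP (s \in pages t); rewrite permE; last by rewrite next_nth (negPf st).
have : next (pages t) s \in pages t by rewrite mem_next.
by rewrite mem_pages => /andP[_ /subsetP]; apply; apply: incident_mem.
Qed.

Variables (k n N L : nat).
Hypothesis k_gt0 : 0 < k.
Hypothesis perm_k : forall f : {perm Q}, f ^+ k = 1.
Hypothesis Qn : #|Q| <= n.+1.
Hypothesis QN : #|Q| <= N.+1.
Hypothesis Ln : k * k.+1 ^ L <= n.+1.
Hypothesis LN : #|{perm ({ffun T -> {perm 'I_n.+1}} * 'I_n.+1)}| +
  L * #|{perm ({ffun T -> {perm 'I_n.+1}} * 'I_n.+1)}| <= N.+1.

Local Notation hub := ({perm ({ffun T -> {perm 'I_N.+1}} * 'I_N.+1)} * Q)%type.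
Local Notation coset := (X * {set hub})%type.
Local Notation orbit := (@orb X T incident k n N Q rotate).
Local Notation at_ := (@at_hub X T incident k n N Q rotate).

Let rotate_valid : valid incident k n rotate.
Proof. by move=> z w w'; apply: small_act_valid. Qed.

(** By [live_at], this depends on the orbit only and not on the chosen hub of it. *)
Definition live (c : coset) (o : hub) := [&& at_ c o, page o.2 & c.1 \in codom o.2].

(* Pairs whose second component is not an orbit are isolated vertices. *)
Definition host_edge : rel coset := fun c d =>
  differ c.1 d.1 && [exists o, live c o && live d o].

Lemma host_edge_sym : symmetric host_edge.
Proof.
move=> c d; rewrite /host_edge differ_sym; congr (_ && _).
by apply: eq_existsb => o; rewrite andbC.
Qed.

Lemma host_edge_irrefl : irreflexive host_edge.
Proof. by move=> c; rewrite /host_edge differ_irrefl. Qed.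

Definition host := SGraph host_edge_sym host_edge_irrefl.

Lemma live_at c o o' : live c o -> at_ c o' -> live c o'.
Proof.
case/and3P=> co ps xs co'; have [w cw E] := at_hub_conn co co'.
rewrite /live co' E; have [-> ->] := rotate_live cw ps xs.
by [].
Qed.

Definition page_map (o : hub) (a : A) : host := (o.2 a, orbit (o.2 a) o).

Lemma live_page_map o a : page o.2 -> live (page_map o a) o.
Proof. by move=> ps; rewrite /live ps /at_hub /= eqxx codom_f. Qed.

Lemma page_map_embedding o : page o.2 -> embedding (page_map o).
Proof.
move=> ps; have /pageP[si sE] := ps.
split=> [a b E|a b]; first exact: si (congr1 fst E).
rewrite /= /host_edge /= sE andbC -[RHS]andTb; congr (_ && _).
by apply/existsP; exists o; apply/andP; split; apply: live_page_map.
Qed.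

(** Rotating by the letter formed by the two points stays in both orbits and reaches every page
    through these points, in particular one that maps [u] and [v] to them. *)
Lemma host_edge_page (c d : host) : edge c d ->
  exists f : A -> host, [/\ embedding f, f u = c & f v = d].
Proof.
case/andP=> cd /existsP[o /andP[co do_]].
have [s' [ps' s'u s'v]] := page_through cd.
have /and3P[c_o ps cs] := co; have /and3P[d_o _ ds] := do_.
pose t : T := [set c.1; d.1].
have ot : o.2 \in pages t.
  by rewrite mem_pages ps; apply/subsetP=> z /set2P[]->.
have s't : s' \in pages t.
  by rewrite mem_pages ps'; apply/subsetP=> z /set2P[]->; rewrite -?s'u -?s'v codom_f.
have [j Ej] := rotate_connect ot s't.
pose o' := move incident k n rotate (nseq j t) o.
have o'2 : o'.2 = s' by [].
have ct : incident c.1 t by apply/existsP; exists d.1; rewrite cd eqxx.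
have dt : incident d.1 t.
  by apply/existsP; exists c.1; rewrite differ_sym cd setUC eqxx.
have co' : at_ c o'.
  by apply: (at_hub_move rotate_valid QN c_o); rewrite all_nseq ct orbT.
have do' : at_ d o'.
  by apply: (at_hub_move rotate_valid QN d_o); rewrite all_nseq dt orbT.
exists (page_map o'); split.
- by apply: page_map_embedding; rewrite o'2.
- by rewrite /page_map o'2 s'u -(eqP co') -surjective_pairing.
- by rewrite /page_map o'2 s'v -(eqP do') -surjective_pairing.
Qed.

Lemma host_has_edge : exists c d : host, edge c d.
Proof.
have [_ E] := @page_map_embedding (1, base_page) page_base.
by exists (page_map (1, base_page) u), (page_map (1, base_page) v); rewrite E.
Qed.

Lemma host_free (C : sgraph) : connected C -> ~ has_cut_vertex C ->
    ~ has_adjacent_two_vertex_cut C -> #|C| < L ->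
  induced_free A C -> induced_free host C.
Proof.
move=> Cc Cv Ca CL CfreeA /contains_inducedP[phi [phi_inj phiE]]; apply: CfreeA.
apply/contains_inducedP.
case: (classic (exists x y : C, edge x y)) => [Ce|nCe]; last first.
  have C1 (x y : C) : x = y.
    have /connectP[[|z p] /=] := connected_connect x y Cc; first by [].
    by case/andP=> xz; case: nCe; exists x, z.
  exists (fun=> u); split=> [x y _|x y]; first exact: C1.
  by rewrite (C1 x y) !edge_irrefl.
have nbr (x : C) : exists y, edge x y.
  have [x0 [y0 xy0]] := Ce.
  have /connectP[[|z p] /=] := connected_connect x x0 Cc.
    by move=> _ Ex; exists y0; rewrite -Ex.
  by case/andP=> xz _ _; exists z.
have phi_live x o : at_ (phi x) o -> live (phi x) o.
  have [y] := nbr x; rewrite -phiE => /andP[_ /existsP[o' /andP[xo' _]]].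
  exact: live_at xo'.
have [o all_o] : exists o, forall x, at_ (phi x) o.
  apply: (common_hub incident_pair incident_triple k_gt0 rotate_valid QN Ln LN
            phi_inj _ _ Cc Cv Ca CL Ce).
    move=> x y; rewrite -phiE => /andP[_ /existsP[o /andP[xo yo]]].
    by apply/meetP; exists o; [case/and3P: xo | case/and3P: yo].
  move=> x y o xy xo yo [t /andP[xt yt]]; rewrite -phiE.
  apply/andP; split; last first.
    apply/existsP; exists o; apply/andP.
    by split; [apply: (phi_live _ _ xo) | apply: (phi_live _ _ yo)].
  have xy1 : (phi x).1 != (phi y).1 by apply: at_hub_neq xo yo; rewrite (inj_eq phi_inj).
  exact: (incidentP xy1 xt (incident_mem yt)).2.
have op : page o.2.
  by have [x0 _] := Ce; have /and3P[] := phi_live x0 o (all_o x0).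
have in_o x : (phi x).1 \in codom o.2 by have /and3P[] := phi_live x o (all_o x).
have /pageP[si sE] := op.
(* The page at the common hub contains all points of the copy, so its inverse maps [C] into [A]. *)
pose f x := iinv (in_o x).
have fE x : o.2 (f x) = (phi x).1 by apply: f_iinv.
exists f; split=> [x y E|x y].
  apply/eqP; apply: contraT => xy.
  have := at_hub_neq (_ : phi x != phi y) (all_o x) (all_o y).
  by rewrite (inj_eq phi_inj) -!fE E eqxx => /(_ xy).
rewrite -phiE -sE !fE /= /host_edge -[LHS]andbT; congr (_ && _).
apply/esym/existsP; exists o; apply/andP.
by split; apply: (phi_live _ _ (all_o _)).
Qed.

End Host.

(** * Existence of the deletion host *)

Theorem theorem4p4 (H : sgraph) (S : {set H})
    (C_connected : connected (induced S))
    (C_no_cut_vertex : ~ has_cut_vertex (induced S))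
    (C_no_adjacent_cut : ~ has_adjacent_two_vertex_cut (induced S))
    (u v : H) (e0_nonedge : nonedge u v)
    (e0_free : induced_free (add_edge u v) (induced S)) :
  exists G : sgraph, deletion_host H G.
Proof.
have [uDv uNv] := andP e0_nonedge.
have uvA : @edge (add_edge u v) u v by rewrite /= /add_edge_rel uDv eqxx orbT.
pose Q := {ffun H -> {ffun H * H -> H}}.
have [k k0 perm_k] : exists2 k, 0 < k & forall f : {perm Q}, f ^+ k = 1.
  exists #|[set: {perm Q}]|; first by rewrite cardG_gt0.
  by move=> f; apply: expg_cardG; rewrite inE.
pose L := #|induced S|.+1.
(* [n] depends on [k] and [L], and [N] on the order of the group determined by [n]. *)
have [n [Qn Ln]] : exists n, #|Q| <= n.+1 /\ k * k.+1 ^ L <= n.+1.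
  by exists (#|Q| + k * k.+1 ^ L); rewrite -addnS leq_addr addnS leqW ?leq_addl.
pose m := #|{perm ({ffun {set {ffun H * H -> H}} -> {perm 'I_n.+1}} * 'I_n.+1)}|.
have [N [QN LN]] : exists N, #|Q| <= N.+1 /\ m + L * m <= N.+1.
  exists (#|Q| + (m + L * m)).
  by rewrite -addnS leq_addr addnS leqW ?leq_addl.
exists (host (add_edge u v) k n N); split.
- exact: (host_has_edge uvA k n N).
- case/contains_inducedP=> f [f_inj fE].
  have := @host_free (add_edge u v) u _ _ _ _ k0 perm_k Qn QN Ln LN _
            C_connected C_no_cut_vertex
            C_no_adjacent_cut (ltnSn _) e0_free.
  case; apply/contains_inducedP; exists (f \o val).
  split=> [|x y]; first exact: inj_comp f_inj val_inj.
  exact: fE (val x) (val y).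
(* Deleting the edge between [f u] and [f v] cancels the edge put in by [add_edge], so the page
   becomes a copy of [H]. *)
- move=> c d /(host_edge_page uvA perm_k Qn QN)[f [[f_inj fE] <- <-]].
  apply/contains_inducedP; exists f; split=> // x y.
  have f_set (a b : H) : [set f a; f b] = f @: [set a; b] by rewrite imsetU1 imset_set1.
  rewrite /= /del_edge_rel fE !f_set (inj_eq (imset_inj f_inj)) /= /add_edge_rel.
  have [E|_] := eqVneq [set x; y] [set u; v]; last by rewrite andbF orbF andbT.
  rewrite andbF; apply/esym/negP=> xy; case/negP: uNv.
  have [xu yu] : x \in [set u; v] /\ y \in [set u; v].
    by rewrite -E set21 set22.
  have xDy : x != y by apply: contraTneq xy => ->; rewrite edge_irrefl.
  case/set2P: xu xy xDy => ->; case/set2P: yu => ->; rewrite ?eqxx //.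
  by rewrite edge_sym.
Qed.
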